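(* Let $(J,g)$ be an almost Hermitian structure on a $2n$-dimensional manifold $M$, with corresponding $G$-structure $P(H)$, $H=U(n)$, and let $\nabla$ be the Riemannian connection of $g$. Then the canonical connection $\overline\nabla$ of $(P(H),g)$ is $$\overline\nabla_XY=\tfrac12(\nabla_XY-J\nabla_XJY)=\nabla_XY+\tfrac12\nabla_X(J)JY,$$ and its second fundamental tensor field $h=\nabla-\overline\nabla$ is $$h_XY=-\tfrac12\nabla_X(J)JY=\tfrac12(\nabla_XY+J\nabla_XJY),$$ for all vector fields $X,Y$ on $M$.
   Context: An almost Hermitian structure is a pair $(J,g)$ with $J$ a $(1,1)$ tensor field, $J^2=-I$, and $g=\langle\,,\rangle$ a Riemannian metric with $\langle JX,JY\rangle=\langle X,Y\rangle$. $P(H)$ is the subbundle of the orthonormal frame bundle $O(M)$ of those frames in which $J$ has matrix $\begin{pmatrix}0&E_n\\-E_n&0\end{pmatrix}$; its structure group is $H=U(n)\subset O(2n)$. $\nabla_X(J)$ is the covariant derivative of $J$. Canonical connection: let $P(H)\subset O(M)$ be a principal subbundle with group $H\subset O(m)$, $m=\dim M$, $\mathfrak o=\mathfrak o(m)=\mathfrak h\oplus\mathfrak m$ with $\mathfrak h$ the Lie algebra of $H$ and $\mathfrak m=\mathfrak h^\perp$ for the biinvariant Killing form. If $\omega$ is the $\mathfrak o$-valued connection form of the Riemannian connection on $O(M)$, then the $\mathfrak h$-component of $\omega|_{P(H)}$ is a connection form in $P(H)$; the corresponding covariant derivative is denoted $\overline\nabla$ (the canonical connection), and $h=\nabla-\overline\nabla$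 is the second fundamental tensor field. *)

(* Defs.v *)
From HB Require Import structures.
From mathcomp Require Import all_boot all_order all_algebra.
From mathcomp Require Import all_classical all_reals all_analysis.

Set Implicit Arguments.
Unset Strict Implicit.
Unset Printing Implicit Defensive.

Import Order.TTheory GRing.Theory Num.Theory.
Import numFieldNormedType.Exports.

Local Open Scope classical_set_scope.
Local Open Scope ring_scope.

Section Smooth.
Context {R : realType} {V : normedModType R}.

Fixpoint Ck (k : nat) (A : set V) (f : V -> R) : Prop :=
  if k is k'.+1 then
    (forall x, A x -> differentiable f x) /\ (forall v, Ck k' A ('D_v f))
  else forall x, A x -> {for x, continuous f}.

(* Only meaningful for open A: continuity and differentiability at the points
   of A involve the values of f on a full neighbourhood. *)
Definition smooth_on (A : set V) (f : V -> R) : Prop := forall k, Ck k A f.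

Definition mx_smooth_on {p q} (A : set V) (F : V -> 'M[R]_(p, q)) : Prop :=
  forall i j, smooth_on A (fun x => F x i j).

Definition mx_derive {p q} (v : V) (F : V -> 'M[R]_(p, q)) (x : V)
    : 'M[R]_(p, q) :=
  \matrix_(i, j) 'D_v (fun y => F y i j) x.

End Smooth.

Record chart (R : realType) (m : nat) (M : topologicalType) := Chart {
  dom : set M;
  to_coord :> M -> 'cV[R]_m;
  of_coord : 'cV[R]_m -> M;
  dom_open : open dom;
  img_open : open (to_coord @` dom);
  to_coordK : forall p, dom p -> of_coord (to_coord p) = p;
  to_coord_continuous : forall p, dom p -> {for p, continuous to_coord};
  of_coord_continuous :
    forall x, (to_coord @` dom) x -> {for x, continuous of_coord} }.

Definition img {R : realType} {m : nat} {M : topologicalType}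
  (phi : chart R m M) : set 'cV[R]_m := phi @` dom phi.

(* The tangent space at p is 'cV[R]_m, a vector being represented by its
   components in the chart chart_at p. So the same column at two different
   points is in general not "the same" vector, and every derivative of a vector
   or frame field must be taken after passing to components in a fixed chart
   (see vcoord, frame_coord). *)
Record manifold (R : realType) (m : nat) := Manifold {
  space :> topologicalType;
  space_hausdorff : hausdorff_space space;
  space_second_countable : @second_countable space;
  atlas : set (chart R m space);
  chart_at : space -> chart R m space;
  chart_atP : forall p, atlas (chart_at p) /\ dom (chart_at p) p;
  atlas_smooth : forall phi psi, atlas phi -> atlas psi ->
    mx_smooth_on (psi @` (dom phi `&` dom psi)) (phi \o of_coord psi) }.

Section Geometry.
Context {R : realType} {m : nat} {M : manifold R m}.
Implicit Types (p : M) (phi psi : chart R m M).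

(* Jacobian matrix at p of the change of coordinates from psi to phi. *)
Definition chjac phi psi p : 'M[R]_m :=
  \matrix_(i, j) 'D_(delta_mx j 0) (fun x => phi (of_coord psi x) i 0) (psi p).

Definition vfield := M -> 'cV[R]_m.
Definition endofield := M -> 'M[R]_m.
Definition formfield := M -> 'M[R]_m.

(* Components in the chart phi, as functions of the coordinate x. *)
Definition vcoord phi (X : vfield) (x : 'cV[R]_m) : 'cV[R]_m :=
  let q := of_coord phi x in chjac phi (chart_at q) q *m X q.

Definition endocoord phi (T : endofield) (x : 'cV[R]_m) : 'M[R]_m :=
  let q := of_coord phi x in
  chjac phi (chart_at q) q *m T q *m chjac (chart_at q) phi q.

Definition formcoord phi (b : formfield) (x : 'cV[R]_m) : 'M[R]_m :=
  let q := of_coord phi x in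
  (chjac (chart_at q) phi q)^T *m b q *m chjac (chart_at q) phi q.

Definition smooth_fun (f : M -> R) : Prop :=
  forall phi, atlas phi -> smooth_on (img phi) (f \o of_coord phi).
Definition smooth_vfield (X : vfield) : Prop :=
  forall phi, atlas phi -> mx_smooth_on (img phi) (vcoord phi X).
Definition smooth_endofield (T : endofield) : Prop :=
  forall phi, atlas phi -> mx_smooth_on (img phi) (endocoord phi T).
Definition smooth_formfield (b : formfield) : Prop :=
  forall phi, atlas phi -> mx_smooth_on (img phi) (formcoord phi b).

Definition inner (g : formfield) p (v w : 'cV[R]_m) : R :=
  (v^T *m g p *m w) 0 0.

Definition riemannian_metric (g : formfield) : Prop :=
  [/\ smooth_formfield g,
      forall p, (g p)^T = g p
    & forall p (v : 'cV[R]_m), v != 0 -> 0 < inner g p v v].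

Definition almost_hermitian (J : endofield) (g : formfield) : Prop :=
  [/\ smooth_endofield J,
      forall p, J p *m J p = - 1%:M,
      riemannian_metric g
    & forall p (v w : 'cV[R]_m),
        inner g p (J p *m v) (J p *m w) = inner g p v w].

Definition dfun (X : vfield) (f : M -> R) p : R :=
  'D_(X p) (f \o of_coord (chart_at p)) (chart_at p p).

Definition lie_bracket (X Y : vfield) : vfield := fun p =>
  let phi := chart_at p in
  mx_derive (X p) (vcoord phi Y) (phi p)
    - mx_derive (Y p) (vcoord phi X) (phi p).

Definition affine_connection (nabla : vfield -> vfield -> vfield) : Prop :=
  [/\ forall X Y, smooth_vfield X -> smooth_vfield Y ->
        smooth_vfield (nabla X Y),
      forall f X Z Y p, smooth_fun f -> smooth_vfield X -> smooth_vfield Z ->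
        smooth_vfield Y ->
        nabla (fun q => f q *: X q + Z q) Y p
          = f p *: nabla X Y p + nabla Z Y p,
      forall X Y Z p, smooth_vfield X -> smooth_vfield Y -> smooth_vfield Z ->
        nabla X (fun q => Y q + Z q) p = nabla X Y p + nabla X Z p
    & forall f X Y p, smooth_fun f -> smooth_vfield X -> smooth_vfield Y ->
        nabla X (fun q => f q *: Y q) p
          = dfun X f p *: Y p + f p *: nabla X Y p].

Definition levi_civita (g : formfield) (nabla : vfield -> vfield -> vfield)
    : Prop :=
  [/\ affine_connection nabla,
      forall X Y p, smooth_vfield X -> smooth_vfield Y ->
        nabla X Y p - nabla Y X p = lie_bracket X Y p
    & forall X Y Z p, smooth_vfield X -> smooth_vfield Y -> smooth_vfield Z ->
        dfun X (fun q => inner g q (Y q) (Z q)) p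
          = inner g p (nabla X Y p) (Z p) + inner g p (Y p) (nabla X Z p)].

Definition apply_endo (T : endofield) (Y : vfield) : vfield :=
  fun p => T p *m Y p.

Definition cov_endo (nabla : vfield -> vfield -> vfield) (X : vfield)
    (T : endofield) (Y : vfield) : vfield :=
  fun p => nabla X (apply_endo T Y) p - T p *m nabla X Y p.

(* A linear frame at p is a pair (p, u); column j of u is the j-th vector of
   the frame. A tangent vector of the frame bundle at (p, u) is a pair (v, B):
   v is the velocity of the base point and B that of the frame matrix, both
   computed in the bundle coordinates induced by chart_at p. *)
Definition frame : Type := (M * 'M[R]_m)%type.
Definition tframe : Type := ('cV[R]_m * 'M[R]_m)%type.

Definition frame_coord phi (f : frame) : 'M[R]_m :=
  chjac phi (chart_at f.1) f.1 *m f.2.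

Definition smooth_frames {V : normedModType R} (A : set V) (c : V -> frame)
    : Prop :=
  [/\ open A,
      forall x, A x -> {for x, continuous (fun y => (c y).1)}
    & forall phi, atlas phi ->
        let B := A `&` [set x | dom phi (c x).1] in
        mx_smooth_on B (fun x => phi (c x).1) /\
        mx_smooth_on B (fun x => frame_coord phi (c x))].

Definition velocity {V : normedModType R} (c : V -> frame) (x w : V) : tframe :=
  let phi := chart_at (c x).1 in
  (mx_derive w (fun y => phi (c y).1) x,
   mx_derive w (fun y => frame_coord phi (c y)) x).

(* c is a smooth curve in P, defined on an open neighbourhood of 0. *)
Definition curve_in (P : set frame) (c : R^o -> frame) : Prop :=
  exists A : set R^o, [/\ A 0, smooth_frames A c & forall t, A t -> P (c t)].

Definition tangent_to (P : set frame) (f : frame) (xi : tframe) : Prop :=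
  exists c, [/\ curve_in P c, c 0 = f & velocity c 0 1 = xi].

Definition orthogonal_group : set 'M[R]_m := [set a | a^T *m a = 1%:M].

Definition orthonormal_frames (g : formfield) : set frame :=
  [set f | f.2^T *m g f.1 *m f.2 = 1%:M].

Definition lie_algebra (G : set 'M[R]_m) : set 'M[R]_m :=
  [set B | exists (A : set R^o) (a : R^o -> 'M[R]_m),
    [/\ open A /\ A 0, mx_smooth_on A a, forall t, A t -> G (a t),
        a 0 = 1%:M & mx_derive (1 : R^o) a 0 = B]].

Definition frame_form : Type := frame -> tframe -> 'M[R]_m.

(* For a in G, the right translation (p, u) |-> (p, u a) has differential
   (v, B) |-> (v, B a); the fundamental vector field of A in the Lie algebra
   is (p, u) |-> (0, u A). Smoothness of the form means that it is smooth in
   every smooth parametrised family of frames in P. *)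
Definition connection_form (P : set frame) (G : set 'M[R]_m)
    (omega : frame_form) : Prop :=
  [/\ forall f xi, P f -> tangent_to P f xi -> lie_algebra G (omega f xi),
      forall f (a : R) v B w C, P f ->
        tangent_to P f (v, B) -> tangent_to P f (w, C) ->
        omega f (a *: v + w, a *: B + C) = a *: omega f (v, B) + omega f (w, C),
      forall f A, P f -> lie_algebra G A -> omega f (0, f.2 *m A) = A,
      forall f v B a, P f -> tangent_to P f (v, B) -> G a ->
        omega (f.1, f.2 *m a) (v, B *m a) = invmx a *m omega f (v, B) *m a
    & forall k (A : set 'cV[R]_k) (c : 'cV[R]_k -> frame) w,
        smooth_frames A c -> (forall x, A x -> P (c x)) ->
        mx_smooth_on A (fun x => omega (c x) (velocity c x w))].

(* nabla_X Y at p is u (xi F_Y), where u is a frame of P at p, xi is the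
   horizontal lift of X p to T_u P, and F_Y (q, u') = u'^-1 (Y q). The
   derivative xi F_Y is taken along a curve in P with velocity xi. *)
Definition covariant_derivative_of (P : set frame) (omega : frame_form)
    (nabla : vfield -> vfield -> vfield) : Prop :=
  forall X Y, smooth_vfield X -> smooth_vfield Y ->
  forall c : R^o -> frame, curve_in P c ->
    let: (p, u) := c 0 in
    (velocity c 0 1).1 = X p ->
    omega (c 0) (velocity c 0 1) = 0 ->
    nabla X Y p = u *m mx_derive (1 : R^o) (fun t => invmx (c t).2 *m Y (c t).1) 0.

(* The orthogonal complement of the Lie algebra of H in o(m) with respect to
   the biinvariant form tr (A B), which is the Killing form of o(m) up to the
   factor m - 2; the Killing form itself vanishes for m = 2. *)
Definition lie_complement (H : set 'M[R]_m) : set 'M[R]_m :=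
  [set B | lie_algebra orthogonal_group B /\
           forall A, lie_algebra H A -> \tr (A *m B) = 0].

Definition lie_component (P : set frame) (H : set 'M[R]_m)
    (omega eta : frame_form) : Prop :=
  forall f xi, P f -> tangent_to P f xi ->
    lie_algebra H (eta f xi) /\ lie_complement H (omega f xi - eta f xi).

Definition canonical_connection (P : set frame) (H : set 'M[R]_m)
    (omega : frame_form) (nablabar : vfield -> vfield -> vfield) : Prop :=
  exists eta, lie_component P H omega eta /\
              covariant_derivative_of P eta nablabar.

Definition riemannian_connection_form (g : formfield)
    (nabla : vfield -> vfield -> vfield) (omega : frame_form) : Prop :=
  connection_form (orthonormal_frames g) orthogonal_group omega /\
  covariant_derivative_of (orthonormal_frames g) omega nabla.

End Geometry.

Arguments vfield {R m} M.
Arguments endofield {R m} M.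
Arguments formfield {R m} M.
Arguments frame {R m} M.
Arguments frame_form {R m} M.
Arguments orthogonal_group {R} m.

Definition std_J (R : realType) (n : nat) : 'M[R]_(n + n) :=
  block_mx 0 1%:M (- 1%:M) 0.

Definition unitary_group (R : realType) (n : nat) : set 'M[R]_(n + n) :=
  [set a | orthogonal_group (n + n) a /\ a *m std_J R n = std_J R n *m a].

Arguments unitary_group R n : clear implicits.

Definition unitary_frames (R : realType) (n : nat) (M : manifold R (n + n))
    (J : endofield M) (g : formfield M) : set (frame M) :=
  [set f | orthonormal_frames g f /\ J f.1 *m f.2 = f.2 *m std_J R n].

(* Main.v *)
Require Import Defs.
From mathcomp Require Import all_boot all_order all_algebra.
From mathcomp Require Import all_classical all_reals all_analysis.
Import Order.TTheory GRing.Theory Num.Theory.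
Import numFieldNormedType.Exports.
Local Open Scope classical_set_scope.
Local Open Scope ring_scope.

Set Implicit Arguments.
Unset Strict Implicit.
Unset Printing Implicit Defensive.

(** Write Jo for the standard complex structure. The Lie algebra of U(n)
    consists of the skew matrices that commute with Jo, and its complement in
    o(2n) for the trace form of those that anticommute with it. Hence a form
    eta as in the definition of the canonical connection is forced to be
    (omega - Jo omega Jo) / 2 on the tangent vectors of the unitary frame
    bundle ([lie_complementP], [lie_component_unique]).

    Let c be a curve of unitary frames u over a curve with initial velocity
    X p, let B = omega (c') at its start, and let W = u^-1 Y be the components
    of Y along it. Then nabla_X Y = u (W' + B W), whether or not c is
    horizontal ([covariant_derivative_along]). Since J u = u Jo, the components
    of J Y are Jo W. If c is horizontal for eta, then B anticommutes with Jo,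
    and the formula applied to Y and to J Y gives
      nabla_X Y = u (W' + B W),   J nabla_X (J Y) = u (- W' + B W).
    Half the difference is u W', which is the derivative of Y for the
    connection eta ([hermitian_connection_along]). The three other formulas
    follow by J (J Y) = - Y.

    This shows at once that (nabla_X Y - J nabla_X (J Y)) / 2 is a covariant
    derivative of eta, which is the existence part. For uniqueness a curve of
    unitary frames that is horizontal for eta is needed through every point in
    every direction ([unitary_horizontal_curve]). A unitary frame along a
    straight line of a chart is produced by a Hermitian Gram-Schmidt process
    that is smooth in the parameter ([hermitian_gram_schmidt]); its velocity is
    then corrected at the starting point by a curve in U(n) with prescribed
    velocity, for which the Cayley transform is used ([cayley]). *)

(** * Closure properties of smooth functions and matrices *)

Lemma open_near (T : topologicalType) (A : set T) (x : T) :
  open A -> A x -> \forall y \near x, A y.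
Proof. by move=> oA Ax; exact: open_nbhs_nbhs. Qed.

Section SmoothCalculus.
Context {R : realType} {V : normedModType R}.
Implicit Types (A B : set V) (f g : V -> R) (v x : V).

(** Both functions have the same value at x and the same remainder near x, so
    the differential of the first one is also that of the second. *)
Lemma near_eq_differentiable (W : normedModType R) (F G : V -> W) x :
  (\forall y \near x, F y = G y) -> differentiable F x -> differentiable G x.
Proof.
move=> FG dF.
have eFG : F x = G x by exact: nbhs_singleton FG.
have [cF FE] := (diff_locallyP _ _).1 dF.
have GE : G \o shift x = cst (G x) + 'd F x +o_ 0 id.
  have sFG : \forall h \near 0, F (h + x) = G (h + x).
    by rewrite (near_shift x) sub0r; near=> y; rewrite /= subrK; near: y.
  move: FE => /eqaddoP FE; apply/eqaddoP => e e0.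
  apply: filterS2 sFG (FE _ e0) => h; rewrite /= eFG.
  by rewrite -/(_ - _) /= !fctE /= => ->.
by apply/diff_locallyP; rewrite (diff_unique cF GE).
Unshelve. all: by end_near. Qed.

(** Openness of A matters: the derivatives of the two functions agree at a
    point of A because the functions agree near it. *)
Lemma Ck_ext k A f g : open A -> (forall x, A x -> f x = g x) ->
  Ck k A f -> Ck k A g.
Proof.
move=> oA; elim: k f g => [|k IH] f g fg /=.
  move=> cf x Ax; have := cf x Ax.
  rewrite /prop_for /continuous_at -fg// => ?.
  apply: cvg_trans; last by eassumption.
  apply: near_eq_cvg; near=> y.
  by apply: fg; near: y; exact: open_near.
move=> [df Df]; split.
  move=> x Ax; apply: near_eq_differentiable (df x Ax).
  by near=> y; apply: fg; near: y; exact: open_near.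
move=> v; apply: IH (Df v) => x Ax; apply: near_eq_derive.
by near=> y; apply: fg; near: y; exact: open_near.
Unshelve. all: by end_near. Qed.

Lemma Ck_sub k A B f : B `<=` A -> Ck k A f -> Ck k B f.
Proof.
move=> BA; elim: k f => [|k IH] f /=; first by move=> cf x /BA/cf.
by move=> [df Df]; split=> [x /BA/df//|v]; exact: IH.
Qed.

Lemma CkS k A f : Ck k.+1 A f -> Ck k A f.
Proof.
elim: k f => [|k IH] f /=.
  by move=> [df _] x Ax; apply: differentiable_continuous; exact: df.
by move=> [df Df]; split=> // v; exact: IH.
Qed.

Lemma Ck_cst k A (a : R) : Ck k A (fun=> a).
Proof.
elim: k a => [|k IH] a /=; first by move=> x _; exact: cst_continuous.
split=> [x _|v]; first exact: differentiable_cst.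
rewrite (_ : 'D_v _ = fun=> 0); first exact: IH.
by apply/funext => x; rewrite derive_cst.
Qed.

Lemma CkD k A f g : open A -> Ck k A f -> Ck k A g ->
  Ck k A (fun x => f x + g x).
Proof.
move=> oA; elim: k f g => [|k IH] f g /=.
  by move=> cf cg x Ax; apply: continuousD; [exact: cf|exact: cg].
move=> [df Df] [dg Dg]; split=> [x Ax|v].
  by apply: differentiableD; [exact: df|exact: dg].
apply: Ck_ext (IH _ _ (Df v) (Dg v)) => // x Ax.
rewrite -deriveD//; apply: diff_derivable; [exact: df|exact: dg].
Qed.

Lemma CkM k A f g : open A -> Ck k A f -> Ck k A g ->
  Ck k A (fun x => f x * g x).
Proof.
move=> oA; elim: k f g => [|k IH] f g.
  by move=> cf cg x Ax; apply: continuousM; [exact: cf|exact: cg].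
move=> cf cg; have [df Df] := cf; have [dg Dg] := cg; split=> [x Ax|v].
  by apply: differentiableM; [exact: df|exact: dg].
have := CkD oA (IH _ _ (CkS cf) (Dg v)) (IH _ _ (CkS cg) (Df v)).
apply: Ck_ext => // x Ax.
by rewrite deriveM//; apply: diff_derivable; [exact: df|exact: dg].
Qed.

(** Induction works because the derivative of the inverse of f is a polynomial
    in f' and the inverse itself, one order lower. *)
Lemma CkV k A f : open A -> (forall x, A x -> f x != 0) -> Ck k A f ->
  Ck k A (fun x => (f x)^-1).
Proof.
move=> oA f0; elim: k => [|k IH] cf.
  by move=> x Ax; apply: continuousV; [exact: f0|exact: cf].
have [df Df] := cf; split=> [x Ax|v].
  by apply: differentiableV; [exact: df|exact: f0].
have cV := IH (CkS cf).
have := CkM oA (Ck_cst k A (-1)) (CkM oA (CkM oA cV cV) (Df v)).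
apply: Ck_ext => // x Ax.
rewrite deriveV; [|exact: f0|by apply: diff_derivable; exact: df].
by rewrite mulN1r -invfM -expr2 scaleNr.
Qed.

Lemma differentiable_sqrt (a : R) : 0 < a -> differentiable (@Num.sqrt R) a.
Proof.
by move=> a0; apply/derivable1_diffP; have [] := is_derive1_sqrt a0.
Qed.

Lemma derive_sqrt_comp f v x : differentiable f x -> 0 < f x ->
  'D_v (fun y => Num.sqrt (f y)) x = 'D_v f x * (2 * Num.sqrt (f x))^-1.
Proof.
move=> df f0; have ds := differentiable_sqrt f0.
rewrite deriveE; last exact: (differentiable_comp df ds).
rewrite (diff_comp df ds) /= [in RHS]deriveE// deriv1E.
  by rewrite derive1E derive_sqrt.
exact/derivable1_diffP.
Qed.

Lemma Ck_sqrt k A f : open A -> (forall x, A x -> 0 < f x) -> Ck k A f ->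
  Ck k A (fun x => Num.sqrt (f x)).
Proof.
move=> oA f0; elim: k => [|k IH] cf.
  move=> x Ax; apply: (@continuous_comp _ _ _ f (@Num.sqrt R)).
    exact: cf.
  exact: sqrt_continuous.
have [df Df] := cf; split=> [x Ax|v].
  apply: (@differentiable_comp _ _ _ _ f (@Num.sqrt R)); first exact: df.
  exact: differentiable_sqrt (f0 _ Ax).
have cS := CkM oA (Ck_cst k A 2) (IH (CkS cf)).
have /(CkV oA)/(_ cS) cV : forall x, A x -> 2 * Num.sqrt (f x) != 0.
  by move=> x Ax; rewrite mulf_neq0// gt_eqF// sqrtr_gt0 f0.
apply: Ck_ext (CkM oA (Df v) cV) => // x Ax.
by rewrite derive_sqrt_comp//; [exact: df|exact: f0].
Qed.

Lemma smooth_sub A B f : B `<=` A -> smooth_on A f -> smooth_on B f.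
Proof. by move=> BA sf k; exact: Ck_sub BA (sf k). Qed.

Lemma smooth_cst A (a : R) : smooth_on A (fun=> a).
Proof. by move=> k; exact: Ck_cst. Qed.

Lemma smooth_ext A f g : open A -> (forall x, A x -> f x = g x) ->
  smooth_on A f -> smooth_on A g.
Proof. by move=> oA fg sf k; exact: Ck_ext fg (sf k). Qed.

Lemma smoothD A f g : open A -> smooth_on A f -> smooth_on A g ->
  smooth_on A (fun x => f x + g x).
Proof. by move=> oA sf sg k; exact: CkD. Qed.

Lemma smoothM A f g : open A -> smooth_on A f -> smooth_on A g ->
  smooth_on A (fun x => f x * g x).
Proof. by move=> oA sf sg k; exact: CkM. Qed.

Lemma smoothV A f : open A -> (forall x, A x -> f x != 0) -> smooth_on A f ->
  smooth_on A (fun x => (f x)^-1).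
Proof. by move=> oA f0 sf k; exact: CkV. Qed.

Lemma smooth_sqrt A f : open A -> (forall x, A x -> 0 < f x) -> smooth_on A f ->
  smooth_on A (fun x => Num.sqrt (f x)).
Proof. by move=> oA f0 sf k; exact: Ck_sqrt. Qed.

Lemma smooth_sum A (I : Type) (r : seq I) (P : pred I) (F : I -> V -> R) :
  open A -> (forall i, P i -> smooth_on A (F i)) ->
  smooth_on A (fun x => \sum_(i <- r | P i) F i x).
Proof.
move=> oA sF; elim: r => [|i r IH].
  by apply: smooth_ext (smooth_cst A 0) => // x _; rewrite big_nil.
case Pi: (P i); last by apply: smooth_ext IH => // x _; rewrite big_cons Pi.
apply: smooth_ext (smoothD oA (sF i Pi) IH) => // x _.
by rewrite big_cons Pi.
Qed.

Lemma smooth_prod A (I : Type) (r : seq I) (F : I -> V -> R) :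
  open A -> (forall i, smooth_on A (F i)) ->
  smooth_on A (fun x => \prod_(i <- r) F i x).
Proof.
move=> oA sF; elim: r => [|i r IH].
  by apply: smooth_ext (smooth_cst A 1) => // x _; rewrite big_nil.
apply: smooth_ext (smoothM oA (sF i) IH) => // x _.
by rewrite big_cons.
Qed.

Lemma smooth_derive A f v : smooth_on A f -> smooth_on A ('D_v f).
Proof. by move=> sf k; have [_] := sf k.+1; exact. Qed.

Lemma smooth_differentiable A f x : smooth_on A f -> A x -> differentiable f x.
Proof. by move=> sf; have [+ _] := sf 1%N; exact. Qed.

Lemma smooth_continuous A f x : smooth_on A f -> A x -> {for x, continuous f}.
Proof. by move=> sf Ax; have := sf 0%N; exact. Qed.

End SmoothCalculus.

Section SmoothMatrices.
Context {R : realType} {V : normedModType R}.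
Implicit Types (A B : set V) (v x : V).

Lemma mx_smooth_sub p q A B (F : V -> 'M[R]_(p, q)) : B `<=` A ->
  mx_smooth_on A F -> mx_smooth_on B F.
Proof. by move=> BA sF i j; exact: smooth_sub BA (sF i j). Qed.

Lemma mx_smooth_ext p q A (F G : V -> 'M[R]_(p, q)) : open A ->
  (forall x, A x -> F x = G x) -> mx_smooth_on A F -> mx_smooth_on A G.
Proof. by move=> oA FG sF i j; apply: smooth_ext (sF i j) => // x /FG ->. Qed.

Lemma mx_smooth_cst p q A (C : 'M[R]_(p, q)) : mx_smooth_on A (fun=> C).
Proof. by move=> i j; exact: smooth_cst. Qed.

Lemma mx_smoothD p q A (F G : V -> 'M[R]_(p, q)) : open A ->
  mx_smooth_on A F -> mx_smooth_on A G -> mx_smooth_on A (fun x => F x + G x).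
Proof.
by move=> oA sF sG i j; under eq_fun do rewrite mxE; exact: smoothD.
Qed.

Lemma mx_smoothZ p q A (f : V -> R) (F : V -> 'M[R]_(p, q)) : open A ->
  smooth_on A f -> mx_smooth_on A F -> mx_smooth_on A (fun x => f x *: F x).
Proof.
by move=> oA sF sG i j; under eq_fun do rewrite mxE; exact: smoothM.
Qed.

Lemma mx_smoothN p q A (F : V -> 'M[R]_(p, q)) : open A ->
  mx_smooth_on A F -> mx_smooth_on A (fun x => - F x).
Proof.
move=> oA sF; under eq_fun do rewrite -scaleN1r.
by apply: mx_smoothZ => //; exact: smooth_cst.
Qed.

Lemma mx_smoothM p q r A (F : V -> 'M[R]_(p, q)) (G : V -> 'M[R]_(q, r)) :
  open A -> mx_smooth_on A F -> mx_smooth_on A G ->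
  mx_smooth_on A (fun x => F x *m G x).
Proof.
move=> oA sF sG i j; under eq_fun do rewrite mxE.
by apply: smooth_sum => // k _; exact: smoothM.
Qed.

Lemma mx_smooth_tr p q A (F : V -> 'M[R]_(p, q)) :
  mx_smooth_on A F -> mx_smooth_on A (fun x => (F x)^T).
Proof. by move=> sF i j; under eq_fun do rewrite mxE; exact: sF. Qed.

Lemma mx_smooth_row p q r A (F : V -> 'M[R]_(p, q)) (G : V -> 'M[R]_(p, r)) :
  mx_smooth_on A F -> mx_smooth_on A G ->
  mx_smooth_on A (fun x => row_mx (F x) (G x)).
Proof.
move=> sF sG i j; under eq_fun do rewrite mxE.
by case: (fintype.split j) => k; [exact: sF|exact: sG].
Qed.

Lemma smooth_det p A (F : V -> 'M[R]_p) : open A -> mx_smooth_on A F ->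
  smooth_on A (fun x => \det (F x)).
Proof.
move=> oA sF; apply: smooth_sum => // s _; apply: smoothM => //.
  exact: smooth_cst.
by apply: smooth_prod => // i; exact: sF.
Qed.

(** The inverse is the adjugate divided by the determinant. *)
Lemma mx_smooth_inv p A (F : V -> 'M[R]_p) : open A -> mx_smooth_on A F ->
  (forall x, A x -> F x \in unitmx) -> mx_smooth_on A (fun x => invmx (F x)).
Proof.
move=> oA sF uF.
have sadj : mx_smooth_on A (fun x => \adj (F x)).
  move=> i j; under eq_fun do rewrite mxE.
  apply: smoothM => //; first exact: smooth_cst.
  apply: smooth_det => // k l; under eq_fun do rewrite !mxE; exact: sF.
have sdet : smooth_on A (fun x => (\det (F x))^-1).
  apply: smoothV => //; last exact: smooth_det.
  by move=> x /uF; rewrite unitmxE unitfE.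
apply: mx_smooth_ext (mx_smoothZ oA sdet sadj) => // x Ax.
by rewrite /invmx uF.
Qed.

End SmoothMatrices.

Section SmoothAffine.
Context {R : realType} {V : normedModType R}.

Lemma is_diff_line (x0 v : V) (t : R^o) :
  is_diff t (fun s : R^o => x0 + s *: v) (fun s => s *: v).
Proof.
have -> : (fun s : R^o => x0 + s *: v) = cst x0 + (fun s : R^o => s *: v) by [].
by apply: is_diff_eq; rewrite add0r.
Qed.

Lemma line_continuous (x0 v : V) : continuous (fun s : R^o => x0 + s *: v).
Proof.
move=> t; apply: differentiable_continuous.
exact: (@ex_diff _ _ _ _ _ _ _ (is_diff_line x0 v t)).
Qed.

Lemma open_line (A : set V) (x0 v : V) : open A ->
  open [set t : R^o | A (x0 + t *: v)].
Proof.
by move=> oA; apply: open_comp => // t _; exact: line_continuous.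
Qed.

Lemma derive_line (f : V -> R) (x0 v : V) (s t : R^o) :
  differentiable f (x0 + t *: v) ->
  'D_s (fun t : R^o => f (x0 + t *: v)) t = s * 'D_v f (x0 + t *: v).
Proof.
move=> df; have [dl dlE] := is_diff_line x0 v t.
rewrite deriveE; last exact: (differentiable_comp dl df).
by rewrite (diff_comp dl df) /= dlE linearZ /= -deriveE.
Qed.

(** Derivatives along an affine line are multiples of directional derivatives of
    f, so that no chain rule of higher order is needed. *)
Lemma Ck_line k (A : set V) (f : V -> R) (x0 v : V) : open A -> Ck k A f ->
  Ck k [set t : R^o | A (x0 + t *: v)] (fun t : R^o => f (x0 + t *: v)).
Proof.
move=> oA; elim: k f => [|k IH] f.
  move=> cf t At; apply: (@continuous_comp _ _ _ (fun s : R^o => x0 + s *: v) f).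
    exact: line_continuous.
  exact: cf.
move=> [df Df]; split=> [t At|s].
  apply: (@differentiable_comp _ _ _ _ (fun s : R^o => x0 + s *: v) f).
    exact: (@ex_diff _ _ _ _ _ _ _ (is_diff_line x0 v t)).
  exact: df.
have oL := @open_line A x0 v oA.
apply: Ck_ext (CkM oL (Ck_cst k _ s) (IH _ (Df v))) => // t At.
by rewrite derive_line//; exact: df.
Qed.

Lemma smooth_id (A : set R^o) : smooth_on A (fun t : R^o => t : R).
Proof.
case=> [|k] /=; first by move=> t _; exact: cvg_id.
split=> [t _|v]; first exact: (@ex_diff _ _ _ _ _ _ _ (is_diff_id t)).
rewrite (_ : 'D_v _ = fun=> v); first exact: Ck_cst.
by apply/funext => t; rewrite derive_id.
Qed.

Lemma mx_smooth_line p q (A : set V) (F : V -> 'M[R]_(p, q)) (x0 v : V) :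
  open A -> mx_smooth_on A F ->
  mx_smooth_on [set t : R^o | A (x0 + t *: v)] (fun t : R^o => F (x0 + t *: v)).
Proof. by move=> oA sF i j k; exact: Ck_line (sF i j k). Qed.
End SmoothAffine.

(** * Derivatives of matrix functions; the Lie algebras of O(m) and U(n) *)

Section MatrixDerivatives.
Context {R : realType} {V : normedModType R}.
Implicit Types (A : set V) (v x : V).

Definition mx_differentiable p q (F : V -> 'M[R]_(p, q)) x :=
  forall i j, differentiable (fun y => F y i j) x.

Lemma mx_smooth_differentiable p q A (F : V -> 'M[R]_(p, q)) x :
  mx_smooth_on A F -> A x -> mx_differentiable F x.
Proof. by move=> sF Ax i j; exact: smooth_differentiable (sF i j) Ax. Qed.

Lemma mx_differentiable_near p q (F G : V -> 'M[R]_(p, q)) x :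
  (\forall y \near x, F y = G y) -> mx_differentiable F x ->
  mx_differentiable G x.
Proof.
move=> FG dF i j; apply: near_eq_differentiable (dF i j).
by apply: filterS FG => y ->.
Qed.

Lemma mx_derive_near p q (F G : V -> 'M[R]_(p, q)) v x :
  (\forall y \near x, F y = G y) -> mx_derive v F x = mx_derive v G x.
Proof.
move=> FG; apply/matrixP => i j; rewrite !mxE; apply: near_eq_derive.
by apply: filterS FG => y ->.
Qed.

Lemma mx_derive_cst p q (C : 'M[R]_(p, q)) v x : mx_derive v (fun=> C) x = 0.
Proof. by apply/matrixP => i j; rewrite !mxE derive_cst. Qed.

Lemma mx_derive_tr p q (F : V -> 'M[R]_(p, q)) v x :
  mx_derive v (fun y => (F y)^T) x = (mx_derive v F x)^T.
Proof.
by apply/matrixP => i j; rewrite !mxE; congr ('D_v _ x); apply/funext => y;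
  rewrite mxE.
Qed.

Lemma mx_differentiableM p q r (F : V -> 'M[R]_(p, q)) (G : V -> 'M[R]_(q, r)) x :
  mx_differentiable F x -> mx_differentiable G x ->
  mx_differentiable (fun y => F y *m G y) x.
Proof.
move=> dF dG i j.
rewrite (_ : (fun y => _) = \sum_k (fun y => F y i k * G y k j)).
  by apply: differentiable_sum => k; exact: differentiableM.
by apply/funext => y; rewrite mxE fct_sumE.
Qed.

Lemma derive_sum_fun n (f : 'I_n -> V -> R) v x :
  (forall k, differentiable (f k) x) ->
  'D_v (fun y => \sum_k f k y) x = \sum_k 'D_v (f k) x.
Proof.
move=> df; rewrite -derive_sum; last by move=> k; exact: diff_derivable.
by congr ('D_v _ x); apply/funext => y; rewrite fct_sumE.
Qed.

Lemma mx_deriveM p q r (F : V -> 'M[R]_(p, q)) (G : V -> 'M[R]_(q, r)) v x :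
  mx_differentiable F x -> mx_differentiable G x ->
  mx_derive v (fun y => F y *m G y) x =
  mx_derive v F x *m G x + F x *m mx_derive v G x.
Proof.
move=> dF dG; apply/matrixP => i j; rewrite !mxE.
rewrite (_ : (fun y => _) = (fun y => \sum_k F y i k * G y k j)); last first.
  by apply/funext => y; rewrite mxE.
rewrite derive_sum_fun; last by move=> k; exact: differentiableM.
rewrite -big_split; apply: eq_bigr => k _ /=.
rewrite deriveM;
  [|apply: diff_derivable; exact: dF|apply: diff_derivable; exact: dG].
by rewrite !mxE addrC; congr (_ + _); exact: mulrC.
Qed.

Lemma mx_differentiable_cst p q (C : 'M[R]_(p, q)) x :
  mx_differentiable (fun=> C) x.
Proof. by move=> i j; exact: differentiable_cst. Qed.

Lemma col_sum_delta m (w : 'cV[R]_m) : w = \sum_k w k 0 *: delta_mx k 0.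
Proof.
apply/matrixP => i j; rewrite summxE (bigD1 i)//= !mxE !ord1 !eqxx mulr1.
rewrite big1 ?addr0// => k ki; rewrite !mxE.
by rewrite eq_sym (negPf ki) mulr0.
Qed.

Lemma differentiable_col m (F : V -> 'cV[R]_m) x :
  mx_differentiable F x -> differentiable F x.
Proof.
move=> dF; rewrite (_ : F = \sum_k (fun y => F y k 0 *: delta_mx k 0)).
  by apply: differentiable_sum => k; exact: differentiableZl.
by apply/funext => y; rewrite fct_sumE -col_sum_delta.
Qed.

Lemma diff_colE m (F : V -> 'cV[R]_m) v x :
  mx_differentiable F x -> 'd F x v = mx_derive v F x.
Proof.
move=> dF; rewrite -deriveE; last exact: differentiable_col.
by rewrite derive_mx//; apply: diff_derivable; exact: differentiable_col.
Qed.

(** The chain rule in coordinates. Differentiability of F is known entrywise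
    only, and F is a sum of its entries times the basis vectors. *)
Lemma derive_comp_col m (F : V -> 'cV[R]_m) (f : 'cV[R]_m -> R) v x :
  mx_differentiable F x -> differentiable f (F x) ->
  'D_v (fun y => f (F y)) x =
  \sum_k 'D_(delta_mx k 0) f (F x) * mx_derive v F x k 0.
Proof.
move=> dF df; have dF' := differentiable_col dF.
rewrite deriveE; last exact: (differentiable_comp dF' df).
rewrite (diff_comp dF' df) /= diff_colE// [X in 'd _ _ X]col_sum_delta.
rewrite linear_sum; apply: eq_bigr => k _.
by rewrite linearZ /= -deriveE// mulrC.
Qed.

Lemma mx_differentiable_comp m p q (F : V -> 'cV[R]_m)
    (G : 'cV[R]_m -> 'M[R]_(p, q)) x :
  mx_differentiable F x ->
  (forall i j, differentiable (fun w => G w i j) (F x)) ->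
  mx_differentiable (fun y => G (F y)) x.
Proof.
move=> dF dG i j.
by apply: (differentiable_comp (differentiable_col dF) (dG i j)).
Qed.

End MatrixDerivatives.

Section LieAlgebras.
Context {R : realType}.

Lemma scale_half_double (W : lmodType R) (x : W) : 2^-1 *: (x + x) = x.
Proof.
by rewrite -mulr2n -[x *+ 2]scaler_nat scalerA mulVf ?scale1r//.
Qed.

Section Cayley.
Context {m : nat} (B : 'M[R]_m).
Hypothesis skewB : B^T = - B.

Definition cayley_den (t : R^o) : 'M[R]_m := 1%:M - (t / 2) *: B.
Definition cayley_num (t : R^o) : 'M[R]_m := 1%:M + (t / 2) *: B.

(** The Cayley transform of t B / 2: a curve of orthogonal matrices with
    value 1 and velocity B at t = 0, whose entries are rational in t, so that
    its smoothness needs no exponential series. *)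
Definition cayley (t : R^o) : 'M[R]_m := invmx (cayley_den t) *m cayley_num t.

(** If w (1 + C) = 0, then w w^T = - w C w^T, which vanishes for a skew C. *)
Lemma skew_add1_unit (C : 'M[R]_m) : C^T = - C -> 1%:M + C \in unitmx.
Proof.
move=> skC; rewrite unitmxE unitfE; apply/negP => /eqP/eqP/det0P[w w0].
rewrite mulmxDr mulmx1 => /eqP; rewrite addr_eq0 => /eqP wC.
have q0 : (w *m C *m w^T) = 0.
  (* The form of a skew matrix is a 1 x 1 matrix equal to its opposite. *)
  have : (w *m C *m w^T)^T = - (w *m C *m w^T).
    by rewrite !trmx_mul trmxK skC mulmxA mulmxN mulNmx.
  move=> /matrixP/(_ 0 0); rewrite !mxE => /eqP.
  rewrite -addr_eq0 -mulr2n mulrn_eq0 /= => /eqP q0.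
  by apply/matrixP => i j; rewrite !ord1 mxE q0 mxE.
have : (w *m w^T) 0 0 = 0.
  by rewrite {1}wC mulNmx q0 oppr0 mxE.
rewrite mxE => /eqP; rewrite psumr_eq0; last first.
  by move=> i _; rewrite mxE -expr2 sqr_ge0.
move=> /allP w2; move/negP: w0; apply; apply/eqP/rowP => i.
have := w2 i (mem_index_enum _); rewrite !mxE -expr2 sqrf_eq0 /=.
by move=> /eqP.
Qed.

Lemma skewZ (a : R) : (a *: B)^T = - (a *: B).
Proof. by rewrite linearZ /= skewB scalerN. Qed.

Lemma cayley_num_unit t : cayley_num t \in unitmx.
Proof. by apply: skew_add1_unit; exact: skewZ. Qed.

Lemma cayley_den_unit t : cayley_den t \in unitmx.
Proof. by apply: skew_add1_unit; rewrite linearN /= skewZ. Qed.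

Lemma tr_cayley_den t : (cayley_den t)^T = cayley_num t.
Proof. by rewrite linearB /= trmx1 skewZ opprK. Qed.

Lemma tr_cayley_num t : (cayley_num t)^T = cayley_den t.
Proof. by rewrite linearD /= trmx1 skewZ. Qed.

Lemma cayley_comm t :
  cayley_den t *m cayley_num t = cayley_num t *m cayley_den t.
Proof.
rewrite /cayley_num /cayley_den !(mulmxDl, mulmxDr, mul1mx, mulmx1, mulNmx, mulmxN).
by rewrite !addrA addrK subrK.
Qed.

Lemma cayley0 : cayley 0 = 1%:M.
Proof.
by rewrite /cayley /cayley_den /cayley_num mul0r scale0r subr0 addr0 invmx1 mul1mx.
Qed.

Lemma cayley_orthogonal t : orthogonal_group m (cayley t).
Proof.
rewrite /orthogonal_group /= /cayley trmx_mul trmx_inv tr_cayley_den tr_cayley_num.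
have uN := cayley_num_unit t; have uD := cayley_den_unit t.
apply: mulmx1C; rewrite mulmxA -(mulmxA _ (cayley_num t)) -cayley_comm.
by rewrite mulmxA mulVmx// mul1mx mulmxV.
Qed.

(** What keeps the curve inside U(n) when B commutes with Jo. *)
Lemma cayley_commutes (Q : 'M[R]_m) t : B *m Q = Q *m B ->
  cayley t *m Q = Q *m cayley t.
Proof.
move=> BQ; have uD := cayley_den_unit t.
have nQ : cayley_num t *m Q = Q *m cayley_num t.
  by rewrite mulmxDl mulmxDr mul1mx mulmx1 -scalemxAl BQ scalemxAr.
have dQ : cayley_den t *m Q = Q *m cayley_den t.
  by rewrite mulmxBl mulmxBr mul1mx mulmx1 -scalemxAl BQ scalemxAr.
rewrite /cayley -mulmxA nQ !mulmxA; congr (_ *m _).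
by rewrite -[LHS](mulmxK uD) -(mulmxA _ Q) -dQ mulmxA mulVmx// mul1mx.
Qed.

Lemma smooth_scaled_line (C : 'M[R]_m) (a : R) :
  mx_smooth_on setT (fun t : R^o => 1%:M + (t * a) *: C).
Proof.
apply: mx_smoothD; [exact: openT|exact: mx_smooth_cst|].
apply: mx_smoothZ; [exact: openT| |exact: mx_smooth_cst].
by apply: smoothM; [exact: openT|exact: smooth_id|exact: smooth_cst].
Qed.

Lemma smooth_cayley_num : mx_smooth_on setT cayley_num.
Proof. exact: smooth_scaled_line. Qed.

Lemma smooth_cayley_den : mx_smooth_on setT cayley_den.
Proof.
rewrite /cayley_den; under eq_fun do rewrite -scalerN.
exact: smooth_scaled_line.
Qed.

Lemma smooth_cayley : mx_smooth_on setT cayley.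
Proof.
have oT : open [set: R^o] by exact: openT.
apply: mx_smoothM => //; last exact: smooth_cayley_num.
apply: mx_smooth_inv => //; first exact: smooth_cayley_den.
by move=> t _; exact: cayley_den_unit.
Qed.

Lemma derive_scaled_line (C : 'M[R]_m) (a : R) :
  mx_derive (1 : R^o) (fun t : R^o => 1%:M + (t * a) *: C) 0 = a *: C.
Proof.
apply/matrixP => i j; rewrite !mxE.
have -> : (fun y : R^o => (1%:M + (y * a) *: C) i j) =
    (fun y : R^o => (1%:M : 'M[R]_m) i j + y *: (a * C i j) : R^o).
  by apply/funext => y; rewrite !mxE -mulrA.
have [dl dlE] := @is_diff_line R R^o ((1%:M : 'M[R]_m) i j) (a * C i j) 0.
by rewrite deriveE// dlE scale1r.
Qed.

Lemma derive_cayley_num : mx_derive (1 : R^o) cayley_num 0 = 2^-1 *: B.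
Proof. exact: derive_scaled_line. Qed.

Lemma derive_cayley_den : mx_derive (1 : R^o) cayley_den 0 = - (2^-1 *: B).
Proof.
rewrite /cayley_den; under eq_fun do rewrite -scalerN.
by rewrite derive_scaled_line scalerN.
Qed.

(** Differentiate (1 - t B / 2) a = 1 + t B / 2 at t = 0, where a = 1; this
    avoids the derivative of an inverse matrix. *)
Lemma derive_cayley : mx_derive (1 : R^o) cayley 0 = B.
Proof.
have dd : mx_differentiable cayley_den 0.
  exact: mx_smooth_differentiable smooth_cayley_den I.
have da : mx_differentiable cayley 0.
  exact: mx_smooth_differentiable smooth_cayley I.
have := mx_deriveM (1 : R^o) dd da.
rewrite (_ : (fun y => _) = cayley_num); last first.
  by apply/funext => t; rewrite /cayley mulmxA mulmxV ?cayley_den_unit ?mul1mx.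
rewrite derive_cayley_num derive_cayley_den cayley0 mulmx1.
rewrite /cayley_den mul0r scale0r subr0 mul1mx => /eqP.
rewrite addrC eq_sym subr_eq -scalerDr => /eqP ->.
exact: scale_half_double.
Qed.

End Cayley.

Lemma skew_of_curve m (A : set R^o) (a : R^o -> 'M[R]_m) :
  open A -> A 0 -> mx_smooth_on A a ->
  (forall t, A t -> orthogonal_group m (a t)) -> a 0 = 1%:M ->
  (mx_derive (1 : R^o) a 0)^T = - mx_derive (1 : R^o) a 0.
Proof.
move=> oA A0 sa orth a0; have da := mx_smooth_differentiable sa A0.
have daT : mx_differentiable (fun t => (a t)^T) 0.
  exact: mx_smooth_differentiable (mx_smooth_tr sa) A0.
have := mx_deriveM (1 : R^o) daT da.
rewrite mx_derive_tr a0 trmx1 mul1mx mulmx1.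
rewrite (@mx_derive_near _ _ _ _ _ (fun=> 1%:M)); last first.
  by apply: filterS (open_near oA A0) => t /orth.
by rewrite mx_derive_cst => /esym/eqP; rewrite addr_eq0 => /eqP.
Qed.

Lemma lie_orthogonalP m (B : 'M[R]_m) :
  lie_algebra (orthogonal_group m) B <-> B^T = - B.
Proof.
split=> [[A [a [[oA A0] sa orth a0 <-]]]|skB].
  exact: skew_of_curve orth a0.
exists setT, (cayley B); split=> //.
- by split=> //; exact: openT.
- exact: smooth_cayley.
- by move=> t _; exact: cayley_orthogonal.
- exact: cayley0.
- exact: derive_cayley.
Qed.

Lemma lie_unitaryP n (B : 'M[R]_(n + n)) :
  lie_algebra (unitary_group R n) B <->
  B^T = - B /\ B *m std_J R n = std_J R n *m B.
Proof.
split=> [[A [a [[oA A0] sa un a0 <-]]]|[skB BJ]].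
  split; first by apply: (skew_of_curve oA A0 sa) => // t /un[].
  have da := mx_smooth_differentiable sa A0.
  have dJ := mx_differentiable_cst (std_J R n) (0 : R^o).
  have := mx_deriveM (1 : R^o) da dJ; have := mx_deriveM (1 : R^o) dJ da.
  rewrite !mx_derive_cst mulmx0 mul0mx addr0 add0r => <- <-.
  apply: mx_derive_near.
  by apply: filterS (open_near oA A0) => t /un[].
exists setT, (cayley B); split=> //.
- by split=> //; exact: openT.
- exact: smooth_cayley.
- move=> t _; split; first exact: cayley_orthogonal.
  exact: cayley_commutes.
- exact: cayley0.
- exact: derive_cayley.
Qed.

Lemma std_JJ n : std_J R n *m std_J R n = - 1%:M.
Proof.
rewrite /std_J mulmx_block !mul0mx !mulmx0 !mulmx1 !mul1mx !addr0 add0r.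
by rewrite [in RHS]scalar_mx_block opp_block_mx !oppr0.
Qed.

Lemma tr_std_J n : (std_J R n)^T = - std_J R n.
Proof.
by rewrite /std_J tr_block_mx opp_block_mx linearN /= !trmx0 trmx1 !oppr0 opprK.
Qed.

(** The orthogonal projection onto the matrices commuting with Jo. *)
Definition commuting_part n (B : 'M[R]_(n + n)) :=
  2^-1 *: (B - std_J R n *m B *m std_J R n).

Lemma commuting_partP n (B : 'M[R]_(n + n)) :
  commuting_part B *m std_J R n = std_J R n *m commuting_part B.
Proof.
rewrite /commuting_part -scalemxAl -scalemxAr; congr (_ *: _).
rewrite mulmxBl mulmxBr !mulmxA std_JJ -!mulmxA std_JJ.
by rewrite mulNmx !mul1mx !mulmxN !mulmx1 !opprK addrC.
Qed.

Lemma complement_partE n (B : 'M[R]_(n + n)) :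
  B - commuting_part B = 2^-1 *: (B + std_J R n *m B *m std_J R n).
Proof.
rewrite -[X in X - _]scale_half_double /commuting_part -scalerBr.
by rewrite opprB addrACA subrr addr0.
Qed.

Lemma complement_partP n (B : 'M[R]_(n + n)) :
  (B - commuting_part B) *m std_J R n = - (std_J R n *m (B - commuting_part B)).
Proof.
rewrite complement_partE -scalemxAl -scalemxAr -scalerN; congr (_ *: _).
rewrite mulmxDl mulmxDr !mulmxA std_JJ -!mulmxA std_JJ.
by rewrite mulNmx !mul1mx !mulmxN !mulmx1 opprD opprK addrC.
Qed.

Lemma commuting_part_skew n (B : 'M[R]_(n + n)) : B^T = - B ->
  (commuting_part B)^T = - commuting_part B.
Proof.
move=> skB; rewrite /commuting_part linearZ linearB /= !trmx_mul tr_std_J skB.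
rewrite -scalerN; congr (_ *: _).
by rewrite !(mulNmx, mulmxN, opprK) opprB addrC mulmxA.
Qed.

Lemma commuting_part_lie n (B : 'M[R]_(n + n)) : B^T = - B ->
  lie_algebra (unitary_group R n) (commuting_part B).
Proof.
by move=> skB; apply/lie_unitaryP; split;
  [exact: commuting_part_skew|exact: commuting_partP].
Qed.

(** With J J = -1, cyclicity of the trace gives
    tr (A B) = - tr (A B J J) = tr (A J B J) = tr (J A B J) = - tr (A B). *)
Lemma anticomm_trace n (A B : 'M[R]_(n + n)) :
  A *m std_J R n = std_J R n *m A -> B *m std_J R n = - (std_J R n *m B) ->
  \tr (A *m B) = 0.
Proof.
move=> AJ BJ.
have : \tr (A *m B) = - \tr (A *m B).
  have {1}-> : A *m B = - (A *m B *m std_J R n *m std_J R n).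
    by rewrite -mulmxA std_JJ mulmxN mulmx1 opprK.
  rewrite -(mulmxA A B) BJ mulmxN mulNmx opprK mulmxA AJ.
  rewrite mxtrace_mulC !mulmxA std_JJ mulNmx mul1mx.
  by rewrite mulNmx linearN.
by move/eqP; rewrite -addr_eq0 -mulr2n mulrn_eq0 /= => /eqP.
Qed.

(** For a skew A, - tr (A A) is the sum of the squares of the entries. *)
Lemma skew_trace_eq0 m (A : 'M[R]_m) : A^T = - A -> \tr (A *m A) = 0 -> A = 0.
Proof.
move=> skA trA.
have : \tr (A^T *m A) = 0 by rewrite skA mulNmx linearN /= trA oppr0.
move/eqP; rewrite /mxtrace psumr_eq0; last first.
  move=> i _; rewrite mxE sumr_ge0// => j _.
  by rewrite mxE -expr2 sqr_ge0.
move=> /allP sq; apply/matrixP => i j; rewrite mxE.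
have := sq j (mem_index_enum _); rewrite mxE psumr_eq0; last first.
  by move=> k _; rewrite mxE -expr2 sqr_ge0.
move=> /allP/(_ i (mem_index_enum _)); rewrite mxE -expr2 sqrf_eq0 /=.
by move/eqP.
Qed.

(** If B is orthogonal to the Lie algebra of U(n), then it is orthogonal to its
    own commuting part C, and tr (C B) = tr (C C), so that C = 0. *)
Lemma lie_complementP n (B : 'M[R]_(n + n)) :
  lie_complement (unitary_group R n) B <->
  B^T = - B /\ B *m std_J R n = - (std_J R n *m B).
Proof.
split=> [[/lie_orthogonalP skB ortho]|[skB BJ]]; last first.
  split; first exact/lie_orthogonalP.
  by move=> A /lie_unitaryP[_ AJ]; exact: anticomm_trace.
split=> //.
suff cB0 : commuting_part B = 0.
  by have := complement_partP B; rewrite cB0 subr0.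
apply: skew_trace_eq0; first exact: commuting_part_skew.
rewrite -[X in _ *m X](subKr B) mulmxBr linearB /=.
rewrite ortho; last exact: commuting_part_lie.
rewrite anticomm_trace ?subr0//; [exact: commuting_partP|exact: complement_partP].
Qed.

End LieAlgebras.

(** * Changes of coordinates *)

Section Charts.
Context {R : realType} {m : nat} {M : manifold R m}.
Implicit Types (p q : M) (phi psi chi : chart R m M).

Definition overlap phi psi : set 'cV[R]_m := psi @` (dom phi `&` dom psi).

Lemma overlap_coord phi psi p : dom phi p -> dom psi p -> overlap phi psi (psi p).
Proof. by move=> fp sp; exists p. Qed.

Lemma img_of_coord psi x : img psi x ->
  dom psi (of_coord psi x) /\ psi (of_coord psi x) = x.
Proof. by move=> [p sp <-]; rewrite to_coordK. Qed.

Lemma overlapP phi psi x : overlap phi psi x <->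
  img psi x /\ dom phi (of_coord psi x).
Proof.
split=> [[p [fp sp] <-]|[ix fx]]; first by split; [exists p|rewrite to_coordK].
by have [sx <-] := img_of_coord ix; exists (of_coord psi x).
Qed.

Lemma open_overlap phi psi : open (overlap phi psi).
Proof.
rewrite openE => x /overlapP[ix fx].
have ni : \forall y \near x, img psi y.
  by apply: open_near ix; exact: img_open.
have cx : {for x, continuous (of_coord psi)} by exact: of_coord_continuous.
have nd : \forall y \near x, dom phi (of_coord psi y).
  by apply: cx; apply: open_near fx; exact: dom_open.
by apply: filterS2 ni nd => y iy fy; apply/overlapP.
Qed.

Lemma smooth_transition phi psi : atlas phi -> atlas psi ->
  mx_smooth_on (overlap phi psi) (fun x => phi (of_coord psi x)).
Proof. by move=> aphi apsi; exact: atlas_smooth. Qed.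

Lemma chjacE phi psi p i j : chjac phi psi p i j =
  mx_derive (delta_mx j 0) (fun x => phi (of_coord psi x)) (psi p) i 0.
Proof. by rewrite !mxE. Qed.

Lemma smooth_chjac phi psi : atlas phi -> atlas psi ->
  mx_smooth_on (overlap phi psi) (fun x => chjac phi psi (of_coord psi x)).
Proof.
move=> aphi apsi i j.
have := smooth_derive (delta_mx j 0) (smooth_transition aphi apsi i 0).
apply: smooth_ext; first exact: open_overlap.
by move=> x /overlapP[/img_of_coord[_ xE] _]; rewrite mxE xE.
Qed.

(** The Jacobian of the transition map transforms velocities; as c ranges over
    a family with any parameter space, this covers curves in M as well as the
    inverses of charts, hence the cocycle rule for Jacobians. *)
Lemma derive_change_chart (V : normedModType R) phi psi (c : V -> M) (x v : V) :
  atlas phi -> atlas psi -> dom phi (c x) -> dom psi (c x) ->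
  (\forall y \near x, dom psi (c y)) ->
  mx_differentiable (fun y => psi (c y)) x ->
  mx_differentiable (fun y => phi (c y)) x /\
  mx_derive v (fun y => phi (c y)) x =
    chjac phi psi (c x) *m mx_derive v (fun y => psi (c y)) x.
Proof.
move=> aphi apsi fx sx nd dc.
have dT i : differentiable (fun w => phi (of_coord psi w) i 0) (psi (c x)).
  have /(_ i 0) := smooth_transition aphi apsi.
  by move=> /smooth_differentiable; apply; exact: overlap_coord.
have E : \forall y \near x, phi (of_coord psi (psi (c y))) = phi (c y).
  by apply: filterS nd => y sy; rewrite to_coordK.
split.
  apply: mx_differentiable_near E _.
  apply: (mx_differentiable_comp (G := fun w => phi (of_coord psi w))) => // i j.
  by rewrite ord1.
rewrite -(mx_derive_near v E); apply/matrixP => i j.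
rewrite ord1 !mxE.
rewrite (derive_comp_col (f := fun w => phi (of_coord psi w) i 0))//.
by apply: eq_bigr => k _; rewrite !mxE.
Qed.

Lemma chjac_id phi p : dom phi p -> chjac phi phi p = 1%:M.
Proof.
move=> fp; apply/matrixP => i j; rewrite chjacE.
rewrite (@mx_derive_near _ _ _ _ _ (fun x => x)); last first.
  have oi : open (img phi) by exact: img_open.
  have ip : img phi (phi p) by exists p.
  by apply: filterS (open_near oi ip) => x /img_of_coord[].
rewrite mxE.
have dc : differentiable (fun y : 'cV[R]_m => y i 0) (phi p).
  exact: differentiable_coord.
have di : derivable (fun y : 'cV[R]_m => y) (phi p) (delta_mx j 0).
  exact: derivable_id.
have := derive_mx di; rewrite derive_id => /matrixP/(_ i 0).
by rewrite !mxE eqxx andbT => <-.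
Qed.

Lemma chjac_comp phi psi chi p : atlas phi -> atlas psi -> atlas chi ->
  dom phi p -> dom psi p -> dom chi p ->
  chjac phi psi p *m chjac psi chi p = chjac phi chi p.
Proof.
move=> aphi apsi achi fp sp cp.
have opc := overlap_coord sp cp.
have dpc : mx_differentiable (fun x => psi (of_coord chi x)) (chi p).
  exact: mx_smooth_differentiable (smooth_transition apsi achi) opc.
have cK : of_coord chi (chi p) = p by exact: to_coordK.
have nd : \forall y \near chi p, dom psi (of_coord chi y).
  have := open_near (@open_overlap psi chi) opc.
  by apply: filterS => y /overlapP[].
apply/matrixP => i j; rewrite mxE [RHS]chjacE.
have := derive_change_chart (delta_mx j 0) aphi apsi (c := of_coord chi)
  (x := chi p).
rewrite cK => /(_ fp sp nd dpc)[_ ->]; rewrite mxE.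
by apply: eq_bigr => k _; rewrite [chjac psi chi p k j]chjacE.
Qed.

Lemma chjac_inv phi psi p : atlas phi -> atlas psi -> dom phi p -> dom psi p ->
  chjac phi psi p *m chjac psi phi p = 1%:M.
Proof. by move=> aphi apsi fp sp; rewrite chjac_comp// chjac_id. Qed.

Lemma chjac_unit phi psi p : atlas phi -> atlas psi -> dom phi p -> dom psi p ->
  chjac phi psi p \in unitmx.
Proof.
by move=> aphi apsi fp sp; case/mulmx1_unit: (chjac_inv aphi apsi fp sp).
Qed.

End Charts.

(** * Curves of frames and the covariant derivative along them *)

Section Fields.
Context {R : realType} {m : nat} {M : manifold R m}.
Implicit Types (p q : M) (phi psi : chart R m M).

Lemma chart_at_atlas p : atlas (chart_at p).
Proof. by have [] := chart_atP p. Qed.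

Lemma chart_at_dom p : dom (chart_at p) p.
Proof. by have [] := chart_atP p. Qed.

Hint Resolve chart_at_atlas chart_at_dom : core.

Lemma chjac_atK phi q : atlas phi -> dom phi q ->
  chjac (chart_at q) phi q *m chjac phi (chart_at q) q = 1%:M.
Proof. by move=> aphi fq; exact: chjac_inv. Qed.

Lemma chjac_at_unit phi q : atlas phi -> dom phi q ->
  chjac phi (chart_at q) q \in unitmx.
Proof. by move=> aphi fq; exact: chjac_unit. Qed.

Lemma smooth_apply_endo (T : endofield M) (Y : vfield M) :
  smooth_endofield T -> smooth_vfield Y -> smooth_vfield (apply_endo T Y).
Proof.
move=> sT sY phi aphi; have oi : open (img phi) by exact: img_open.
apply: mx_smooth_ext (mx_smoothM oi (sT phi aphi) (sY phi aphi)) => // x.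
move=> /img_of_coord[fx _].
rewrite /endocoord /vcoord /apply_endo -!mulmxA; congr (_ *m (_ *m _)).
by rewrite mulmxA chjac_atK// mul1mx.
Qed.

Lemma smooth_fun_cst (a : R) : smooth_fun (fun _ : M => a).
Proof. by move=> phi _; exact: smooth_cst. Qed.

Lemma dfun_cst (X : vfield M) (a : R) p : dfun X (fun=> a) p = 0.
Proof. by rewrite /dfun derive_cst. Qed.

End Fields.

Section FrameCurves.
Context {R : realType} {m : nat} {M : manifold R m}.
Hint Resolve chart_at_atlas chart_at_dom : core.

Section Families.
Context {V : normedModType R}.
Implicit Types (A : set V) (c : V -> @frame R m M) (x v : V).

Lemma open_in_chart A c (phi : chart R m M) : smooth_frames A c ->
  open (A `&` [set x | dom phi (c x).1]).
Proof.
move=> [oA cc _]; rewrite openE => x [Ax fx].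
have nA := open_near oA Ax.
have nd : \forall y \near x, dom phi (c y).1.
  have cx := cc x Ax; apply: cx.
  exact: open_near (dom_open phi) fx.
by apply: filterS2 nA nd => y Ay fy; split.
Qed.

Definition frame_mul c (a : V -> 'M[R]_m) : V -> @frame R m M :=
  fun x => ((c x).1, (c x).2 *m a x).

Lemma smooth_frame_mul A B c (a : V -> 'M[R]_m) : smooth_frames A c ->
  open B -> mx_smooth_on B a -> smooth_frames (A `&` B) (frame_mul c a).
Proof.
move=> sc oB sa; have [oA cc sm] := sc; split; first exact: openI.
  by move=> x [Ax _]; exact: cc.
move=> phi aphi; have [sb sf] := sm phi aphi.
have sub : A `&` B `&` [set x | dom phi (c x).1] `<=`
    A `&` [set x | dom phi (c x).1] by move=> x [[Ax Bx] fx].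
split; first exact: mx_smooth_sub sub sb.
have oD : open (A `&` B `&` [set x | dom phi (c x).1]).
  by rewrite setIAC; apply: openI => //; exact: open_in_chart.
have saD := mx_smooth_sub (B := A `&` B `&` [set x | dom phi (c x).1])
  (fun x (h : _ x) => h.1.2) sa.
apply: mx_smooth_ext (mx_smoothM oD (mx_smooth_sub sub sf) saD) => // x _.
by rewrite /frame_coord /= mulmxA.
Qed.

Lemma base_differentiable A c (phi : chart R m M) x : smooth_frames A c -> A x ->
  atlas phi -> dom phi (c x).1 -> mx_differentiable (fun y => phi (c y).1) x.
Proof.
move=> [_ _ sm] Ax aphi fx; have [sb _] := sm phi aphi.
exact: mx_smooth_differentiable sb (conj Ax fx).
Qed.

Lemma frame_coord_differentiable A c (phi : chart R m M) x :
  smooth_frames A c -> A x -> atlas phi -> dom phi (c x).1 ->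
  mx_differentiable (fun y => frame_coord phi (c y)) x.
Proof.
move=> [_ _ sm] Ax aphi fx; have [_ sf] := sm phi aphi.
exact: mx_smooth_differentiable sf (conj Ax fx).
Qed.

(** The Leibniz rule in the chart at the base point, where the frame is its own
    coordinate matrix. *)
Lemma velocity_mul A B c (a : V -> 'M[R]_m) x v : smooth_frames A c ->
  A x -> open B -> B x -> mx_smooth_on B a -> a x = 1%:M ->
  velocity (frame_mul c a) x v =
  ((velocity c x v).1, (velocity c x v).2 + (c x).2 *m mx_derive v a x).
Proof.
move=> sc Ax oB Bx sa ax; rewrite /velocity /=; congr (_, _).
set phi := chart_at (c x).1.
have df : mx_differentiable (fun y => frame_coord phi (c y)) x.
  exact: frame_coord_differentiable sc Ax (chart_at_atlas _) (chart_at_dom _).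
have da := mx_smooth_differentiable sa Bx.
have -> : (fun y => frame_coord phi (frame_mul c a y)) =
    (fun y => frame_coord phi (c y) *m a y).
  by apply/funext => y; rewrite /frame_coord /= mulmxA.
rewrite mx_deriveM// ax mulmx1; congr (_ + _ *m _).
by rewrite /frame_coord chjac_id ?mul1mx//; exact: chart_at_dom.
Qed.

(** In a fixed chart the components u^-1 Y are the inverse of the coordinate
    matrix of the frame applied to the coordinates of Y: the Jacobians of the
    pointwise chosen charts cancel. *)
Lemma components_differentiable A c (Y : vfield M) x : smooth_frames A c ->
  A x -> (forall y, A y -> (c y).2 \in unitmx) -> smooth_vfield Y ->
  mx_differentiable (fun y => invmx (c y).2 *m Y (c y).1) x.
Proof.
move=> sc Ax uc sY; set phi := chart_at (c x).1.
have aphi : atlas phi by exact: chart_at_atlas.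
have fx : dom phi (c x).1 by exact: chart_at_dom.
have [oA _ /(_ phi aphi)[sb sf]] := sc.
pose D := A `&` [set x | dom phi (c x).1].
have oD : open D := open_in_chart phi sc.
have Dx : D x by [].
have uf y : D y -> frame_coord phi (c y) \in unitmx.
  by move=> [Ay fy]; rewrite unitmx_mul chjac_at_unit//= uc.
have dinv : mx_differentiable (fun y => invmx (frame_coord phi (c y))) x.
  exact: mx_smooth_differentiable (mx_smooth_inv oD sf uf) Dx.
have dY : mx_differentiable (fun y => vcoord phi Y (phi (c y).1)) x.
  apply: (mx_differentiable_comp (F := fun y => phi (c y).1)).
    exact: base_differentiable sc Ax aphi fx.
  apply: mx_smooth_differentiable (sY phi aphi) _.
  by exists (c x).1.
apply: mx_differentiable_near (mx_differentiableM dinv dY).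
apply: filterS (open_near oD Dx) => y Dy; have [Ay fy] := Dy.
have uJ := chjac_at_unit aphi fy.
rewrite /vcoord to_coordK// mulmxA; congr (_ *m _).
apply/esym; rewrite -[LHS]mul1mx -(mulVmx (uf _ Dy)) -mulmxA; congr (_ *m _).
by rewrite /frame_coord -mulmxA mulmxV ?mulmx1//; exact: uc.
Qed.

End Families.

Implicit Types (c : R^o -> @frame R m M).

Definition right_invariant (P : set (@frame R m M)) (G : set 'M[R]_m) :=
  forall f a, P f -> G a -> P (f.1, f.2 *m a).

Lemma curve_mul (P : set (@frame R m M)) G c (B : set R^o)
    (a : R^o -> 'M[R]_m) : right_invariant P G -> curve_in P c ->
  open B -> B 0 -> mx_smooth_on B a -> (forall t, B t -> G (a t)) ->
  curve_in P (frame_mul c a).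
Proof.
move=> PG [A [A0 sc Pc]] oB B0 sa Ga; exists (A `&` B); split=> //.
  exact: smooth_frame_mul.
by move=> t [At Bt]; apply: PG; [exact: Pc|exact: Ga].
Qed.

Lemma curve_cst (P : set (@frame R m M)) f : P f -> curve_in P (fun=> f).
Proof.
move=> Pf; exists setT; split=> //; split; first exact: openT.
  by move=> x _; exact: cst_continuous.
by move=> phi aphi; split; exact: mx_smooth_cst.
Qed.

Lemma frame_mul0 c a : a 0 = 1%:M -> frame_mul c a 0 = c 0.
Proof. by move=> a0; rewrite /frame_mul a0 mulmx1; case: (c 0). Qed.

Lemma curve_tangent (P : set (@frame R m M)) c :
  curve_in P c -> tangent_to P (c 0) (velocity c 0 1).
Proof. by move=> cP; exists c. Qed.

(** A vertical motion adds a fundamental vector to the velocity, on which the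
    connection form reproduces the Lie algebra element. *)
Lemma connection_form_mul (P : set (@frame R m M)) G omega c (B : set R^o)
    (a : R^o -> 'M[R]_m) : right_invariant P G -> connection_form P G omega ->
  curve_in P c -> open B -> B 0 -> mx_smooth_on B a ->
  (forall t, B t -> G (a t)) -> a 0 = 1%:M ->
  omega (c 0) (velocity (frame_mul c a) 0 1) =
  omega (c 0) (velocity c 0 1) + mx_derive (1 : R^o) a 0.
Proof.
move=> PG [_ lin vert _ _] cP oB B0 sa Ga a0.
have [A [A0 sc Pc]] := cP.
have lA : lie_algebra G (mx_derive (1 : R^o) a 0) by exists B, a.
have Pc0 := Pc 0 A0.
rewrite (velocity_mul _ sc A0 oB B0 sa a0).
have tv : tangent_to P (c 0) (0, (c 0).2 *m mx_derive (1 : R^o) a 0).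
  have kP := curve_cst Pc0.
  have := curve_tangent (curve_mul PG kP oB B0 sa Ga).
  rewrite frame_mul0//.
  have [A' [A'0 sc' _]] := kP.
  rewrite (velocity_mul _ sc' A'0 oB B0 sa a0) /velocity /=.
  by rewrite !mx_derive_cst add0r.
have tc := curve_tangent cP; move: tc.
case: (velocity c 0 1) => v C /= tc.
have := lin (c 0) 1 _ _ _ _ Pc0 tv tc.
rewrite !scale1r add0r vert// => E.
by rewrite [RHS]addrC -E [X in omega _ (_, X)]addrC.
Qed.

Lemma orthonormal_frame_unit (g : formfield M) f :
  orthonormal_frames g f -> f.2 \in unitmx.
Proof. by move=> /mulmx1_unit[]. Qed.

Lemma orthonormal_right_invariant (g : formfield M) :
  right_invariant (orthonormal_frames g) (orthogonal_group m).
Proof.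
move=> f a; rewrite /orthonormal_frames /orthogonal_group /= => uf oa.
rewrite trmx_mul mulmxA -(mulmxA a^T _ (g _)) -(mulmxA a^T _ f.2) uf.
by rewrite mulmx1.
Qed.

(** The covariant derivative along a curve of orthonormal frames that is not
    assumed horizontal: turning the frame by a curve in O(m) that starts at 1
    with velocity - omega (c') makes it horizontal at 0. *)
Lemma covariant_derivative_along (g : formfield M) nabla omega c
    (X Y : vfield M) :
  riemannian_connection_form g nabla omega ->
  curve_in (orthonormal_frames g) c ->
  smooth_vfield X -> smooth_vfield Y ->
  (velocity c 0 1).1 = X (c 0).1 ->
  let W t := invmx (c t).2 *m Y (c t).1 in
  nabla X Y (c 0).1 =
  (c 0).2 *m (mx_derive (1 : R^o) W 0 + omega (c 0) (velocity c 0 1) *m W 0).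
Proof.
move=> [cf cov] cP sX sY vX W.
set B := omega _ _.
have skB : B^T = - B.
  have [lie _ _ _ _] := cf; apply/lie_orthogonalP; apply: lie.
    by have [A [A0 _ Pc]] := cP; exact: Pc.
  exact: curve_tangent.
have skNB : (- B)^T = - - B by rewrite linearN /= skB.
have [D [a [[oD D0] sa oa a0 da]]] : lie_algebra (orthogonal_group m) (- B).
  exact/lie_orthogonalP.
have inv := @orthonormal_right_invariant g.
have dP : curve_in (orthonormal_frames g) (frame_mul c a).
  exact: (curve_mul inv cP oD D0 sa oa).
have := cov X Y sX sY _ dP.
have [A [A0 sc Pc]] := cP.
have hor := connection_form_mul inv cf cP oD D0 sa oa a0.
rewrite frame_mul0// hor da -/B subrr.
have -> : (velocity (frame_mul c a) 0 1).1 = (velocity c 0 1).1.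
  by rewrite (velocity_mul _ sc A0 oD D0 sa a0).
rewrite vX; case E : (c 0) => [p u] /= /(_ erefl erefl) ->.
congr (_ *m _); first by rewrite a0 mulmx1.
have dW : mx_differentiable W 0.
  apply: (components_differentiable sc A0) => // t At.
  exact: orthonormal_frame_unit (Pc t At).
have daT : mx_differentiable (fun t => (a t)^T) 0.
  exact: mx_smooth_differentiable (mx_smooth_tr sa) D0.
have -> : mx_derive (1 : R^o)
    (fun t => invmx ((c t).2 *m a t) *m Y (c t).1) 0 =
    mx_derive (1 : R^o) (fun t => (a t)^T *m W t) 0.
  apply: mx_derive_near; have [oA _ _] := sc.
  apply: filterS2 (open_near oA A0) (open_near oD D0) => t At Dt.
  have ut := orthonormal_frame_unit (Pc t At).
  have uat : (c t).2 *m a t \in unitmx.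
    by rewrite unitmx_mul ut; case/mulmx1_unit: (oa t Dt).
  have K : (a t)^T *m invmx (c t).2 *m ((c t).2 *m a t) = 1%:M.
    by rewrite -mulmxA (mulmxA (invmx _)) mulVmx// mul1mx oa.
  rewrite /W mulmxA; congr (_ *m _).
  by rewrite -[LHS]mul1mx -K (mulmxK uat).
rewrite mx_deriveM// mx_derive_tr da a0 trmx1 mul1mx.
by rewrite skNB opprK addrC.
Qed.

End FrameCurves.

(** * Smooth Hermitian Gram-Schmidt *)

Section GramSchmidt.
Context {R : realType}.

Lemma nonzero_kernel q m (C : 'M[R]_(q, m)) : (q < m)%N ->
  exists2 w : 'cV[R]_m, w != 0 & C *m w = 0.
Proof.
move=> qm; have : kermx C^T != 0.
  rewrite kermx_eq0 -row_leq_rank mxrank_tr -ltnNge.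
  exact: leq_ltn_trans (rank_leq_row C) qm.
case/rowV0Pn => w /sub_kermxP wC w0; exists w^T; first by rewrite trmx_eq0.
by rewrite -[C]trmxK -trmx_mul wC trmx0.
Qed.

Section Pointwise.
Context {m k : nat} (G J : 'M[R]_m) (E : 'M[R]_(m, k)).
Hypotheses (symG : G^T = G) (JJ : J *m J = - 1%:M) (JG : J^T *m G *m J = G).
Hypotheses (orthE : E^T *m G *m E = 1%:M) (orthJE : E^T *m G *m J *m E = 0).

Lemma trJ_form : J^T *m G = - (G *m J).
Proof.
by rewrite -[in RHS]JG -mulmxA JJ mulmxN mulmx1 opprK.
Qed.

(** The form G J is skew, since J^T G = - G J and G is symmetric. *)
Lemma skew_form_eq0 (w : 'cV[R]_m) : w^T *m G *m J *m w = 0.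
Proof.
have : (w^T *m G *m J *m w)^T = - (w^T *m G *m J *m w).
  rewrite !trmx_mul trmxK symG (mulmxA J^T) trJ_form.
  by rewrite mulNmx mulmxN !mulmxA.
move=> /matrixP/(_ 0 0); rewrite !mxE => /eqP.
rewrite -addr_eq0 -mulr2n mulrn_eq0 /= => /eqP q0.
by apply/matrixP => i j; rewrite !ord1 mxE q0 mxE.
Qed.

(** What remains of w after removing its projection onto the span of E and J E.
    The second projection is J E (J E)^T G w, and J^T G = - G J explains the
    sign. *)
Definition residual (w : 'cV[R]_m) : 'cV[R]_m :=
  w - E *m (E^T *m G *m w) + J *m E *m (E^T *m G *m J *m w).

Lemma residual_orth w : E^T *m G *m residual w = 0.
Proof.
rewrite /residual mulmxDr mulmxBr (mulmxA _ E) orthE mul1mx subrr add0r.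
by rewrite !(mulmxA (E^T *m G)) orthJE mul0mx.
Qed.

Lemma residual_orthJ w : E^T *m G *m J *m residual w = 0.
Proof.
rewrite /residual mulmxDr mulmxBr (mulmxA _ E) orthJE mul0mx subr0.
rewrite (mulmxA _ (J *m E)) (mulmxA _ J E) -(mulmxA _ J J) JJ mulmxN mulmx1.
by rewrite mulNmx orthE mulNmx mul1mx subrr.
Qed.

Lemma gram_step (e : 'cV[R]_m) : e^T *m G *m e = 1%:M ->
  E^T *m G *m e = 0 -> E^T *m G *m J *m e = 0 ->
  (row_mx E e)^T *m G *m row_mx E e = 1%:M /\
  (row_mx E e)^T *m G *m J *m row_mx E e = 0.
Proof.
move=> e1 Ee EJe; have eE : e^T *m G *m E = 0.
  apply: (can_inj (@trmxK _ _ _)).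
  by rewrite !trmx_mul trmxK symG trmx0 mulmxA.
have eJE : e^T *m G *m J *m E = 0.
  apply: (can_inj (@trmxK _ _ _)).
  rewrite !trmx_mul trmxK symG trmx0 (mulmxA J^T) trJ_form.
  by rewrite mulNmx mulmxN !mulmxA EJe oppr0.
rewrite tr_row_mx !mul_col_mx !mul_mx_row e1 Ee EJe eE eJE orthE orthJE.
split; first by rewrite scalar_mx_block.
rewrite skew_form_eq0.
by rewrite !row_mx0 col_mx0.
Qed.
End Pointwise.

Section Smooth.
Context {V : normedModType R} {m : nat}.
Variables (A : set V) (x0 : V) (G J : V -> 'M[R]_m).
Hypotheses (oA : open A) (Ax0 : A x0).
Hypotheses (sG : mx_smooth_on A G) (sJ : mx_smooth_on A J).
Hypothesis symG : forall x, A x -> (G x)^T = G x.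
Hypothesis JJ : forall x, A x -> J x *m J x = - 1%:M.
Hypothesis JG : forall x, A x -> (J x)^T *m G x *m J x = G x.
Hypothesis posG : forall w : 'cV[R]_m, w != 0 -> 0 < (w^T *m G x0 *m w) 0 0.

(** Gram-Schmidt over the complex numbers, smoothly in the parameter. A constant
    vector w orthogonal to E and J E at x0 is its own residual there, so the
    residual has positive square length near x0 and can be normalised. *)
Lemma hermitian_gram_schmidt k : (k + k <= m)%N ->
  exists B (E : V -> 'M[R]_(m, k)), [/\ open B /\ B x0, B `<=` A,
    mx_smooth_on B E,
    forall x, B x -> (E x)^T *m G x *m E x = 1%:M
  & forall x, B x -> (E x)^T *m G x *m J x *m E x = 0].
Proof.
elim: k => [|k IH] km.
  exists A, (fun=> 0); split=> // [|x _|x _]; first exact: mx_smooth_cst.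
    by apply/matrixP => -[].
  by apply/matrixP => -[].
have kkm : (k + k < m)%N by apply: leq_trans km; rewrite addSn addnS ltnS leqnSn.
have [B [E [[oB Bx0] BA sE orthE orthJE]]] := IH (ltnW kkm).
(* w is orthogonal to the columns of E and J E at x0; it exists as there are
   only k + k < m of them. *)
have [w w0] := nonzero_kernel
  (col_mx ((E x0)^T *m G x0) ((E x0)^T *m G x0 *m J x0)) kkm.
rewrite mul_col_mx -[0]vsubmxK => /eq_col_mx[]; rewrite !linear0 => Ew EJw.
pose r x := residual (G x) (J x) (E x) w.
pose s x := ((r x)^T *m G x *m r x) 0 0.
have sGB := mx_smooth_sub BA sG; have sJB := mx_smooth_sub BA sJ.
have sET := mx_smooth_tr sE.
have sEG := mx_smoothM oB sET sGB.
have sw : mx_smooth_on B (fun=> w) by exact: mx_smooth_cst.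
have sr : mx_smooth_on B r.
  have s1 := mx_smoothM oB sE (mx_smoothM oB sEG sw).
  have s2 := mx_smoothM oB (mx_smoothM oB sJB sE)
    (mx_smoothM oB (mx_smoothM oB sEG sJB) sw).
  exact: mx_smoothD oB (mx_smoothD oB sw (mx_smoothN oB s1)) s2.
have ss : smooth_on B s.
  by have /(_ 0 0) := mx_smoothM oB (mx_smoothM oB (mx_smooth_tr sr) sGB) sr.
pose B' := B `&` [set x | 0 < s x].
have oB' : open B'.
  rewrite openE => x [Bx sx].
  have nB := open_near oB Bx.
  have cs := smooth_continuous ss Bx.
  have ns : \forall y \near x, 0 < s y by exact: (cvgr_gt (s x) cs).
  by apply: filterS2 nB ns => y By sy; split.
have B'B : B' `<=` B by move=> x [].
have r0 : r x0 = w.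
  by rewrite /r /residual Ew EJw !mulmx0 subr0 addr0.
have B'x0 : B' x0 by split=> //=; rewrite /s r0; exact: posG.
pose e x := (Num.sqrt (s x))^-1 *: r x.
have se : mx_smooth_on B' e.
  apply: mx_smoothZ => //; last exact: mx_smooth_sub sr.
  apply: smoothV => //; first by move=> x [_ sx]; rewrite gt_eqF// sqrtr_gt0.
  by apply: smooth_sqrt => //; [move=> x []|exact: smooth_sub ss].
have step x : B' x ->
    (row_mx (E x) (e x))^T *m G x *m row_mx (E x) (e x) = 1%:M /\
    (row_mx (E x) (e x))^T *m G x *m J x *m row_mx (E x) (e x) = 0.
  move=> [Bx sx]; have Ax := BA x Bx.
  apply: gram_step; [exact: symG|exact: JJ|exact: JG|exact: orthE|exact: orthJE|..].
  - rewrite /e -scalemxAr [(_ *: _)^T]linearZ /= -!scalemxAl scalerA.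
    rewrite [X in _ *: X]mx11_scalar -/(s x) -scalemx1 scalerA -invfM -expr2.
    by rewrite sqr_sqrtr ?ltW// mulVf ?scale1r// gt_eqF.
  - by rewrite -scalemxAr residual_orth ?scaler0//; [exact: orthE|exact: orthJE].
  - rewrite -scalemxAr residual_orthJ ?scaler0//;
      [exact: JJ|exact: orthE|exact: orthJE].
rewrite -addn1; exists B', (fun x => row_mx (E x) (e x)); split.
- by [].
- exact: subset_trans BA.
- by apply: mx_smooth_row => //; exact: mx_smooth_sub sE.
- by move=> x /step[].
- by move=> x /step[].
Qed.
End Smooth.

(** The relation J U = U Jo says that the last n columns are - J times the
    first n ones, so U = (E | - J E) with E from Gram-Schmidt. *)
Lemma local_unitary_frame (V : normedModType R) n (A : set V) (x0 : V)
    (G J : V -> 'M[R]_(n + n)) : open A -> A x0 ->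
  mx_smooth_on A G -> mx_smooth_on A J ->
  (forall x, A x -> (G x)^T = G x) ->
  (forall x, A x -> J x *m J x = - 1%:M) ->
  (forall x, A x -> (J x)^T *m G x *m J x = G x) ->
  (forall w : 'cV[R]_(n + n), w != 0 -> 0 < (w^T *m G x0 *m w) 0 0) ->
  exists B (U : V -> 'M[R]_(n + n)), [/\ open B /\ B x0, B `<=` A,
    mx_smooth_on B U,
    forall x, B x -> (U x)^T *m G x *m U x = 1%:M
  & forall x, B x -> J x *m U x = U x *m std_J R n].
Proof.
move=> oA Ax0 sG sJ symG JJ JG posG.
have [B [E [[oB Bx0] BA sE oE oJE]]] :=
  hermitian_gram_schmidt oA Ax0 sG sJ symG JJ JG posG (leqnn _).
exists B, (fun x => row_mx (E x) (- (J x *m E x))); split=> //.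
- apply: mx_smooth_row => //; apply: mx_smoothN => //; apply: mx_smoothM => //.
  exact: mx_smooth_sub sJ.
- move=> x Bx; have Ax := BA x Bx; have JGN := trJ_form (JJ x Ax) (JG x Ax).
  rewrite tr_row_mx linearN /= trmx_mul !mul_col_mx !mul_mx_row.
  rewrite !mulmxN !mulNmx opprK -(mulmxA (E x)^T (J x)^T) JGN.
  rewrite !mulmxN !mulNmx !mulmxA oE// oJE// -(mulmxA _ (J x) (J x)) JJ//.
  by rewrite mulmxN mulmx1 mulNmx oE// !opprK oppr0 scalar_mx_block.
- move=> x Bx; have Ax := BA x Bx.
  rewrite /std_J mul_mx_row mul_row_block !mulmx0 !mulmxN !mulmx1 opprK.
  by rewrite add0r addr0 mulmxA JJ// mulNmx mul1mx opprK.
Qed.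

End GramSchmidt.

(** * The canonical connection of the unitary frame bundle *)

Section UnitaryFrames.
Context {R : realType} {n : nat} {M : manifold R (n + n)}.
Variables (J : endofield M) (g : formfield M).
Hypothesis JgH : almost_hermitian J g.
Local Notation PH := (unitary_frames J g).

(** Test the invariance of the inner product on the basis vectors. *)
Lemma isometry_mx p : (J p)^T *m g p *m J p = g p.
Proof.
have [_ _ _ iso] := JgH.
apply/matrixP => i j; have := iso p (delta_mx i 0) (delta_mx j 0).
have E (B : 'M[R]_(n + n)) :
    ((delta_mx i 0 : 'cV_(n + n))^T *m B *m (delta_mx j 0 : 'cV_(n + n))) 0 0 =
    B i j.
  by rewrite trmx_delta -rowE -colE !mxE.
by rewrite /inner trmx_mul -E => /esym; rewrite -E => ->; rewrite !mulmxA.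
Qed.

(** The base curve is a straight line in the chart at p. The metric and J are
    pulled back to that chart, where they depend smoothly on the parameter;
    the frame found there is carried back to the pointwise chosen charts by the
    Jacobian D. *)
Lemma unitary_curve p (v : 'cV[R]_(n + n)) :
  exists c : R^o -> @frame R (n + n) M,
    [/\ curve_in PH c, (c 0).1 = p & (velocity c 0 1).1 = v].
Proof.
have [sJ JJ [sg symg posg] _] := JgH.
set phi := chart_at p.
have aphi : atlas phi := chart_at_atlas p.
have fp : dom phi p := chart_at_dom p.
pose l (t : R^o) := phi p + t *: v.
have l0 : l 0 = phi p by rewrite /l scale0r addr0.
pose q t := of_coord phi (l t).
have q0 : q 0 = p by rewrite /q l0 to_coordK.
pose A := [set t : R^o | img phi (l t)].
have oi : open (img phi) by exact: img_open.
have oA : open A by exact: open_line.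
have A0 : A 0 by rewrite /A /= l0; exists p.
pose D t := chjac (chart_at (q t)) phi (q t).
pose D' t := chjac phi (chart_at (q t)) (q t).
have dq t : A t -> dom phi (q t) by move=> /img_of_coord[].
have DD' t : A t -> D t *m D' t = 1%:M by move=> At; exact: chjac_atK (dq t At).
have D'D t : A t -> D' t *m D t = 1%:M by move=> At; exact: mulmx1C (DD' t At).
pose G t := formcoord phi g (l t).
pose K t := endocoord phi J (l t).
have GE t : G t = (D t)^T *m g (q t) *m D t by [].
have KE t : K t = D' t *m J (q t) *m D t by [].
have sG : mx_smooth_on A G by exact: mx_smooth_line (sg phi aphi).
have sK : mx_smooth_on A K by exact: mx_smooth_line (sJ phi aphi).
have symG t : A t -> (G t)^T = G t.
  by rewrite GE !trmx_mul trmxK symg mulmxA.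
have KK t : A t -> K t *m K t = - 1%:M.
  move=> At; rewrite KE !mulmxA -(mulmxA _ (D t)) DD'// mulmx1.
  by rewrite -(mulmxA _ (J _) (J _)) JJ mulmxN mulmx1 mulNmx D'D.
have KG t : A t -> (K t)^T *m G t *m K t = G t.
  move=> At; rewrite KE GE !trmx_mul !mulmxA.
  rewrite -(mulmxA _ (D' t)^T (D t)^T) -(trmx_mul (D t) (D' t)) DD'//.
  rewrite trmx1 mulmx1 -(mulmxA _ (D t) (D' t)) DD'// mulmx1.
  rewrite -(mulmxA (D t)^T _ (g _)) -(mulmxA (D t)^T _ (J _)).
  by rewrite isometry_mx.
have posG (w : 'cV[R]_(n + n)) : w != 0 -> 0 < (w^T *m G 0 *m w) 0 0.
  move=> w0; have := posg (q 0) (D 0 *m w).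
  rewrite /inner GE trmx_mul !mulmxA; apply.
  apply: contra_neq w0 => Dw0.
  by rewrite -[w]mul1mx -(D'D 0 A0) -mulmxA Dw0 mulmx0.
have [B [U [[oB B0] BA sU oU JU]]] :=
  local_unitary_frame oA A0 sG sK symG KK KG posG.
exists (fun t => (q t, D t *m U t)); split=> //.
  exists B; split=> //.
    split=> //=.
      move=> t Bt; apply: (@continuous_comp _ _ _ l (of_coord phi)).
        exact: line_continuous.
      exact: of_coord_continuous (BA t Bt).
    move=> psi apsi.
    have sub : B `&` [set t | dom psi (q t)] `<=`
        [set t | overlap psi phi (phi p + t *: v)].
      by move=> t [Bt st]; apply/overlapP; split=> //; exact: BA.
    have oO := @open_overlap _ _ _ psi phi.
    split.
      apply: mx_smooth_sub sub _.
      exact: mx_smooth_line oO (smooth_transition apsi aphi).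
    have oBd : open (B `&` [set t | dom psi (q t)]).
      have -> : B `&` [set t | dom psi (q t)] =
          B `&` [set t | overlap psi phi (phi p + t *: v)].
        rewrite eqEsubset; split=> t [Bt st]; split=> //; first exact: sub.
        by have [] := (overlapP _ _ _).1 st.
      by apply: openI => //; exact: open_line.
    have sT := mx_smooth_sub sub
      (mx_smooth_line (phi p) v oO (smooth_chjac apsi aphi)).
    have sUB : mx_smooth_on (B `&` [set t | dom psi (q t)]) U.
      by apply: mx_smooth_sub sU => t [].
    apply: mx_smooth_ext (mx_smoothM oBd sT sUB) => // t [Bt st].
    rewrite /frame_coord /= /D mulmxA chjac_comp//;
      [exact: chart_at_atlas|exact: chart_at_dom|exact: dq (BA t Bt)].
  move=> t Bt; have At := BA t Bt; split.
    rewrite /orthonormal_frames /= trmx_mul -(oU t Bt) GE.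
    by rewrite !mulmxA.
  by rewrite /= -mulmxA -JU// KE !mulmxA DD'// mul1mx.
rewrite /velocity /= q0 -/phi.
rewrite (@mx_derive_near _ _ _ _ _ l); last first.
  by apply: filterS (open_near oA A0) => t /img_of_coord[].
apply/matrixP => i j; rewrite !mxE ord1.
have [dl dlE] := @is_diff_line R R^o (phi p i 0) (v i 0) 0.
rewrite (_ : (fun y => _) = (fun s : R^o => phi p i 0 + s *: v i 0 : R^o)).
  by rewrite deriveE// dlE scale1r.
by apply/funext => t; rewrite !mxE.
Qed.
End UnitaryFrames.

Section CanonicalConnection.
Context {R : realType} {n : nat}.

Lemma commuting_partB (A B : 'M[R]_(n + n)) :
  commuting_part (A - B) = commuting_part A - commuting_part B.
Proof.
rewrite /commuting_part -scalerBr mulmxBr mulmxBl; congr (_ *: _).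
rewrite !opprB addrACA [RHS]addrACA; congr (_ + _); exact: addrC.
Qed.

Lemma commuting_part_id (B : 'M[R]_(n + n)) :
  B *m std_J R n = std_J R n *m B -> commuting_part B = B.
Proof.
move=> BJ; rewrite /commuting_part -BJ -mulmxA std_JJ mulmxN mulmx1 opprK.
exact: scale_half_double.
Qed.

Lemma commuting_part_anti (B : 'M[R]_(n + n)) :
  B *m std_J R n = - (std_J R n *m B) -> commuting_part B = 0.
Proof.
move=> /eqP; rewrite -eqr_oppLR => /eqP JB; rewrite /commuting_part -JB.
by rewrite mulNmx -mulmxA std_JJ mulmxN mulmx1 !opprK subrr scaler0.
Qed.

Context {M : manifold R (n + n)}.
Variables (J : endofield M) (g : formfield M).
Variables (nabla : vfield M -> vfield M -> vfield M) (omega : frame_form M).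
Hypothesis JgH : almost_hermitian J g.
Hypothesis LC : levi_civita g nabla.
Hypothesis conn : riemannian_connection_form g nabla omega.
Local Notation PH := (unitary_frames J g).
Local Notation H := (unitary_group R n).

Lemma unitary_curve_orthonormal c : curve_in PH c ->
  curve_in (orthonormal_frames g) c.
Proof. by move=> [A [A0 sc Pc]]; exists A; split=> // t /Pc[]. Qed.

Lemma unitary_right_invariant : right_invariant PH H.
Proof.
move=> f a [uf JU] [oa aJ]; split; first exact: orthonormal_right_invariant.
by rewrite /= mulmxA JU -!mulmxA aJ.
Qed.

Lemma omega_skew f xi : PH f -> tangent_to PH f xi ->
  (omega f xi)^T = - omega f xi.
Proof.
move=> [uf _] [c [cP c0 vc]]; have [[lie _ _ _ _] _] := conn.
apply/lie_orthogonalP; apply: lie => //.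
by exists c; split=> //; exact: unitary_curve_orthonormal.
Qed.

Lemma lie_component_commuting_part :
  lie_component PH H omega (fun f xi => commuting_part (omega f xi)).
Proof.
move=> f xi Pf txi; have sk := omega_skew Pf txi.
split; first exact: commuting_part_lie.
apply/lie_complementP; split; last exact: complement_partP.
by rewrite linearB /= sk commuting_part_skew// opprB addrC opprK.
Qed.

(** The commuting part fixes eta and kills omega - eta. *)
Lemma lie_component_unique eta f xi : lie_component PH H omega eta ->
  PH f -> tangent_to PH f xi -> eta f xi = commuting_part (omega f xi).
Proof.
move=> comp Pf txi.
have [/lie_unitaryP[_ eJ] /lie_complementP[_ dJ]] := comp f xi Pf txi.
by apply/eqP; rewrite eq_sym -subr_eq0 -(commuting_part_id eJ)
  -commuting_partB commuting_part_anti.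
Qed.

Definition hermitian_connection (X Y : vfield M) : vfield M :=
  fun p => 2^-1 *: (nabla X Y p - J p *m nabla X (apply_endo J Y) p).

(** Write W = u^-1 Y for the components of Y; along unitary frames those of
    J Y are Jo W, since J u = u Jo. If B = omega (c') anticommutes with Jo then
    nabla_X Y = u (W' + B W) and J nabla_X JY = u (- W' + B W). *)
Lemma hermitian_connection_along (c : R^o -> frame M) (X Y : vfield M) :
  curve_in PH c -> smooth_vfield X -> smooth_vfield Y ->
  (velocity c 0 1).1 = X (c 0).1 ->
  commuting_part (omega (c 0) (velocity c 0 1)) = 0 ->
  hermitian_connection X Y (c 0).1 =
  (c 0).2 *m mx_derive (1 : R^o) (fun t => invmx (c t).2 *m Y (c t).1) 0.
Proof.
move=> cP sX sY vX B0; have [sJ _ _ _] := JgH.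
have cO := unitary_curve_orthonormal cP.
have sJY := smooth_apply_endo sJ sY.
have [A [A0 sc Pc]] := cP; have [oA _ _] := sc.
rewrite /hermitian_connection.
rewrite (covariant_derivative_along conn cO sX sY vX).
rewrite (covariant_derivative_along conn cO sX sJY vX).
set B := omega _ _ in B0 *; set W := fun t => invmx _ *m _.
have BJ : B *m std_J R n = - (std_J R n *m B).
  by have := complement_partP B; rewrite B0 subr0.
have WJ t : A t -> invmx (c t).2 *m apply_endo J Y (c t).1 = std_J R n *m W t.
  move=> At; have [uf Ju] := Pc t At; have uu := orthonormal_frame_unit uf.
  rewrite /apply_endo /W !mulmxA; congr (_ *m _).
  rewrite -[LHS](mulmxK uu) -(mulmxA _ (J _)) Ju mulmxA mulVmx// mul1mx.
  by [].
have dW : mx_differentiable W 0.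
  apply: (components_differentiable sc A0) => // t At.
  by apply: orthonormal_frame_unit; have [uf _] := Pc t At; exact: uf.
rewrite (WJ 0 A0) (mx_derive_near (G := fun t => std_J R n *m W t)
  (F := fun t => invmx (c t).2 *m apply_endo J Y (c t).1)); last first.
  by apply: filterS (open_near oA A0) => t /WJ.
have dJ := mx_differentiable_cst (std_J R n) (0 : R^o).
rewrite (mx_deriveM _ dJ dW) mx_derive_cst mul0mx add0r (mulmxA B) BJ.
rewrite mulNmx -mulmxA -mulmxBr.
have [_ Ju] := Pc 0 A0.
rewrite (mulmxA (J _)) Ju -(mulmxA (c 0).2) -mulmxBr.
rewrite (mulmxA (std_J R n) (std_J R n)) std_JJ mulNmx mul1mx.
rewrite scalemxAr; congr (_ *m _).
by rewrite opprK addrACA subrr addr0 scale_half_double.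
Qed.

(** Start from any unitary curve, with eta (c') = E, and turn its frames by a
    curve in U(n) that starts at 1 with velocity - E. *)
Lemma unitary_horizontal_curve (X : vfield M) p :
  exists c : R^o -> frame M, [/\ curve_in PH c, (c 0).1 = p,
    (velocity c 0 1).1 = X p
  & commuting_part (omega (c 0) (velocity c 0 1)) = 0].
Proof.
have [c [cP c0 vc]] := unitary_curve JgH p (X p).
have [A [A0 sc Pc]] := cP.
set E := commuting_part (omega (c 0) (velocity c 0 1)).
have skE : E^T = - E.
  apply: commuting_part_skew; apply: omega_skew; first exact: Pc.
  exact: curve_tangent.
have EJ : E *m std_J R n = std_J R n *m E by exact: commuting_partP.
have [D [a [[oD D0] sa Ha a0 da]]] : lie_algebra H (- E).
  by apply/lie_unitaryP; rewrite linearN /= skE mulNmx mulmxN EJ.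
have cm := curve_mul unitary_right_invariant cP oD D0 sa Ha.
have [cf _] := conn.
have hor := connection_form_mul (@orthonormal_right_invariant _ _ _ g) cf
  (unitary_curve_orthonormal cP) oD D0 sa (fun t Dt => (Ha t Dt).1) a0.
exists (frame_mul c a); split=> //.
rewrite frame_mul0// hor da commuting_partB -/E commuting_part_id//.
by rewrite subrr.
Qed.

(** Since J (J Y) = - Y, the first term of the covariant derivative of J at J Y
    is - nabla_X Y. *)
Lemma cov_endo_JJ (X Y : vfield M) p : smooth_vfield X -> smooth_vfield Y ->
  cov_endo nabla X J (apply_endo J Y) p =
  - (nabla X Y p + J p *m nabla X (apply_endo J Y) p).
Proof.
move=> sX sY; have [[_ _ _ leib] _ _] := LC; have [_ JJ _ _] := JgH.
rewrite /cov_endo.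
have -> : apply_endo J (apply_endo J Y) = (fun q => -1 *: Y q).
  by apply/funext => q; rewrite /apply_endo mulmxA JJ mulNmx mul1mx scaleN1r.
rewrite (leib (fun=> -1))//; last exact: smooth_fun_cst.
by rewrite dfun_cst scale0r add0r scaleN1r opprD.
Qed.

End CanonicalConnection.

Theorem theorem5p14 (R : realType) (n : nat) (M : manifold R (n + n))
    (J : endofield M) (g : formfield M)
    (nabla : vfield M -> vfield M -> vfield M) (omega : frame_form M) :
  almost_hermitian J g ->
  levi_civita g nabla ->
  riemannian_connection_form g nabla omega ->
  let PH := unitary_frames J g in
  let H := unitary_group R n in
  (exists nablabar, canonical_connection PH H omega nablabar) /\
  (forall nablabar, canonical_connection PH H omega nablabar ->
    forall (X Y : vfield M) (p : M), smooth_vfield X -> smooth_vfield Y ->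
    let JY := apply_endo J Y in
    let h := nabla X Y p - nablabar X Y p in
    [/\ nablabar X Y p = 2^-1 *: (nabla X Y p - J p *m nabla X JY p),
        nablabar X Y p = nabla X Y p + 2^-1 *: cov_endo nabla X J JY p,
        h = - (2^-1 *: cov_endo nabla X J JY p)
      & h = 2^-1 *: (nabla X Y p + J p *m nabla X JY p)]).
Proof.
move=> JgH LC conn PH H; split.
  exists (hermitian_connection J nabla).
  exists (fun f xi => commuting_part (omega f xi)).
  split; first exact: lie_component_commuting_part conn.
  move=> X Y sX sY c cP; case E : (c 0) => [p u] vX hor.
  have := hermitian_connection_along JgH conn cP sX sY.
  by rewrite E; apply.
move=> nablabar [eta [comp cov]] X Y p sX sY JY h.
have E1 : nablabar X Y p = 2^-1 *: (nabla X Y p - J p *m nabla X JY p).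
  have [c [cP c0 vX hor]] := unitary_horizontal_curve JgH conn X p.
  have etac : eta (c 0) (velocity c 0 1) = 0.
    rewrite (lie_component_unique comp)//; last exact: curve_tangent.
    by have [A [A0 _ Pc]] := cP; exact: Pc.
  have := hermitian_connection_along JgH conn cP sX sY.
  have := cov X Y sX sY c cP.
  rewrite hor etac c0; case E : (c 0) => [q u]; rewrite E /= in c0 *.
  rewrite c0 => /(_ vX erefl) -> /(_ vX erefl) <-.
  by [].
have E2 : 2^-1 *: cov_endo nabla X J JY p =
    - (2^-1 *: (nabla X Y p + J p *m nabla X JY p)).
  by rewrite (cov_endo_JJ JgH LC)// scalerN.
have E3 : h = 2^-1 *: (nabla X Y p + J p *m nabla X JY p).
  rewrite /h E1 -{1}[nabla X Y p]scale_half_double -scalerBr; congr (_ *: _).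
  by rewrite opprB addrACA subrr addr0.
split=> //; last by rewrite E2 opprK.
by rewrite E2 -E3 /h subKr.
Qed.
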